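(* Let $\mathcal{X}$ be an input space, $\mathcal{Y}$ a label space, $\mathcal{Y}'$ an action space, and $\mathcal{D}$ an unknown probability distribution on $\mathcal{X}\times\mathcal{Y}$. Let $W\subseteq\mathbb{R}^p$ and let $\{h_w:\mathcal{X}\to\mathcal{Y}'\}_{w\in W}$ be a parametrized hypothesis class. Let $l:\mathcal{Y}'\times\mathcal{Y}\to[a,b]$ be a bounded loss, and assume that for every $(X,Y)\in\mathcal{X}\times\mathcal{Y}$ the map $w\mapsto l(h_w(X),Y)$ is $L$-Lipschitz on $W$. Fix $\beta\in(0,1)$, $w_0\in W$ and $s>0$, and let the transformation distributions $Q_\theta$, the risks $R_{TRM}$, $R_{TRM,n}$ and the regularizer $\mathrm{Reg}(\theta)$ be as defined in the context. Then for every $\delta\in(0,1]$ there is a sequence $c_n=c_n(\delta,s,p,L,a,b)$, not depending on the sample, on $w$ or on $\theta$, with $c_n\to 0$ as $n\to\infty$, such that for every $n$, with probability at least $1-\delta$ over the draw of an i.i.d. sample $S=\{(X_i,Y_i)\}_{i=1}^n\sim\mathcal{D}^n$, simultaneously for all $w\in W$ and all $\theta=(\alpha_1,\ldots,\alpha_k,\pi_1,\ldots,\pi_K)$ with $\alpha_i\in(0,A_i]$ ($i\in[k]$) and $\pi_i\in[0,1]$ ($i\in[K]$), $$R_{TRM}(h_w,Q_\theta)\le R_{TRM,n}(h_w,Q_\theta)+\frac{1}{\sqrt n}\left(\frac{1}{2s^2}\|w-w_0\|^2+\mathrm{Reg}(\theta)\right)+c_n.$$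
   Context: Transformations: fix integers $0\le k\le K$. For $i\le k$ fix $A_i>0$ and a family of maps $\rho_i(a):\mathcal{X}\to\mathcal{X}$, $a\in[-A_i,A_i]$, with $\rho_i(0)$ the identity; for $k<i\le K$ fix an integer $N_i\ge 2$ and maps $\rho_i(a):\mathcal{X}\to\mathcal{X}$, $a\in\{0,\ldots,N_i-1\}$, with $\rho_i(0)$ the identity. Let $A=\prod_{i=1}^k[-A_i,A_i]\times\prod_{i=k+1}^K\{0,\ldots,N_i-1\}$ and for $a=(a_1,\ldots,a_K)\in A$ let $g_a=\rho_1(a_1)\circ\cdots\circ\rho_K(a_K)$. For $\theta=(\alpha_1,\ldots,\alpha_k,\pi_1,\ldots,\pi_K)$, $Q_\theta$ is the product measure $\prod_{i=1}^K Q_{(i)}$ on $A$, where $Q_{(i)}=(1-\pi_i)\delta_0+\pi_i\,\mathrm{U}[-\alpha_i,\alpha_i]$ for $i\le k$ and $Q_{(i)}=(1-\pi_i)\delta_0+\pi_i\,\mathrm{U}\{0,\ldots,N_i-1\}$ for $k<i\le K$ ($\mathrm{U}$ denotes the uniform distribution, $\delta_0$ the point mass at $0$). Risks: $R_{TRM}(h_w,Q_\theta)=\mathbb{E}_{(X,Y)\sim\mathcal{D}}\mathbb{E}_{a\sim Q_\theta}[l(h_w(g_aX),Y)]$ and $R_{TRM,n}(h_w,Q_\theta)=\frac1n\sum_{i=1}^n\mathbb{E}_{a\sim Q_\theta}[l(h_w(g_aX_i),Y_i)]$. Regularizer: $\mathrm{Reg}(\theta)=\sum_{i=1}^k K_i(\alpha_i,\pi_i)+\sum_{i=k+1}^K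 K_i(\pi_i)$, where, with $\mathcal{B}(q)$ the Bernoulli distribution with parameter $q$ and $\mathrm{KL}$ the Kullback–Leibler divergence, $K_i(\alpha_i,\pi_i)=\log\frac{1-\pi_i}{\beta}+\pi_i\log\frac{\pi_iA_i\beta}{(1-\pi_i)\alpha_i(1-\beta)}=\mathrm{KL}(\mathcal{B}(\pi_i)\|\mathcal{B}(1-\beta))+\pi_i\,\mathrm{KL}(\mathrm{U}[-\alpha_i,\alpha_i]\|\mathrm{U}[-A_i,A_i])$ and $K_i(\pi_i)=\mathrm{KL}\big(\mathcal{B}((1-\tfrac1{N_i})\pi_i)\,\|\,\mathcal{B}((1-\tfrac1{N_i})(1-\beta))\big)$. *)

(* Defs.v *)
From HB Require Import structures.
From mathcomp Require Import all_boot all_order all_algebra.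
From mathcomp Require Import all_classical all_reals all_analysis.
Set Implicit Arguments. Unset Strict Implicit. Unset Printing Implicit Defensive.
Import Order.TTheory GRing.Theory Num.Theory.
Import numFieldNormedType.Exports.
Local Open Scope classical_set_scope.
Local Open Scope ring_scope.

Section TRM.
Variable R : realType.

Definition enorm2 (p : nat) (v : 'rV[R]_p) : R := \sum_(j < p) (v ord0 j) ^+ 2.
Definition enorm (p : nat) (v : 'rV[R]_p) : R := Num.sqrt (enorm2 v).

(** Transformation parameters a = (a_1,...,a_K) are K-tuples of reals;
    a discrete parameter j in {0,...,N_i-1} is represented by the real j%:R.
    Coordinates are indexed by 'I_K, coordinate i being "continuous" iff i < k. *)
Definition tupset (K : nat) (a : K.-tuple R) (i : 'I_K) (t : R) : K.-tuple R :=
  [tuple (if j == i then t else tnth a j) | j < K].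

Definition gmap (X : Type) (K : nat) (rho : 'I_K -> R -> X -> X)
  (a : K.-tuple R) : X -> X :=
  foldr (fun i f => rho i (tnth a i) \o f) id (enum 'I_K).

Definition Aset (K k : nat) (A : 'I_K -> R) (N : 'I_K -> nat) : set (K.-tuple R) :=
  [set a | forall i : 'I_K,
     ((i < k)%N -> - A i <= tnth a i <= A i) /\
     (~~ (i < k)%N -> exists2 j : nat, (j < N i)%N & tnth a i = j%:R)].

(** Expectation of G : R -> R under the i-th factor Q_(i) of Q_theta:
    Q_(i) = (1-pi_i) delta_0 + pi_i U[-alpha_i,alpha_i]   (i < k)
    Q_(i) = (1-pi_i) delta_0 + pi_i U{0,...,N_i-1}        (i >= k). *)
Definition coordE (K k : nat) (N : 'I_K -> nat) (alpha pi : 'I_K -> R)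
  (i : 'I_K) (G : R -> R) : R :=
  if (i < k)%N then
    (1 - pi i) * G 0 + pi i * ((2 * alpha i)^-1 *
        Rintegral lebesgue_measure `[- alpha i, alpha i] G)
  else
    (1 - pi i) * G 0 + pi i * ((N i)%:R^-1 * \sum_(j < N i) G j%:R).

Fixpoint QE_rec (K k : nat) (N : 'I_K -> nat) (alpha pi : 'I_K -> R)
  (ixs : seq 'I_K) (F : K.-tuple R -> R) (a : K.-tuple R) : R :=
  match ixs with
  | [::] => F a
  | i :: ixs' => coordE k N alpha pi i (fun t => QE_rec k N alpha pi ixs' F (tupset a i t))
  end.

(** E_{a ~ Q_theta}[F a], Q_theta = prod_i Q_(i) (product measure, computed as
    the iterated integral over the coordinates 1, ..., K). *)
Definition QE (K k : nat) (N : 'I_K -> nat) (alpha pi : 'I_K -> R)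
  (F : K.-tuple R -> R) : R :=
  QE_rec k N alpha pi (enum 'I_K) F [tuple (0 : R) | _ < K].

Definition R_TRM (dX dY : measure_display) (X : measurableType dX)
  (Y : measurableType dY) (Y' : Type) (D : probability (X * Y)%type R)
  (p : nat) (h : 'rV[R]_p -> X -> Y') (l : Y' -> Y -> R)
  (K k : nat) (N : 'I_K -> nat) (rho : 'I_K -> R -> X -> X)
  (w : 'rV[R]_p) (alpha pi : 'I_K -> R) : R :=
  Rintegral D setT
    (fun z : (X * Y)%type => QE k N alpha pi (fun a => l (h w (gmap rho a z.1)) z.2)).

Definition R_TRM_n (X Y Y' : Type) (n : nat) (S : 'I_n -> (X * Y)%type)
  (p : nat) (h : 'rV[R]_p -> X -> Y') (l : Y' -> Y -> R)
  (K k : nat) (N : 'I_K -> nat) (rho : 'I_K -> R -> X -> X)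
  (w : 'rV[R]_p) (alpha pi : 'I_K -> R) : R :=
  n%:R^-1 * \sum_(i < n)
     QE k N alpha pi (fun a => l (h w (gmap rho a (S i).1)) (S i).2).

(** KL(B(q) || B(r)) for Bernoulli distributions (convention 0 ln 0 = 0,
    which holds in MathComp since ln 0 = 0). *)
Definition KLbern (q r : R) : R :=
  q * ln (q / r) + (1 - q) * ln ((1 - q) / (1 - r)).

(** KL(U[-al,al] || U[-A,A]) = ln (A / al) for 0 < al <= A. *)
Definition KLunif (al A : R) : R := ln (A / al).

Definition Reg (K k : nat) (A : 'I_K -> R) (N : 'I_K -> nat) (beta : R)
  (alpha pi : 'I_K -> R) : R :=
  \sum_(i < K)
    (if (i < k)%N then KLbern (pi i) (1 - beta) + pi i * KLunif (alpha i) (A i)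
     else KLbern ((1 - (N i)%:R^-1) * pi i) ((1 - (N i)%:R^-1) * (1 - beta))).

Definition iid_sample (dO dT : measure_display) (O : measurableType dO)
  (T : measurableType dT) (P : probability O R) (D : probability T R)
  (n : nat) (Z : 'I_n -> O -> T) : Prop :=
  [/\ (forall i, measurable_fun setT (Z i)),
      (forall i (B : set T), measurable B -> P (Z i @^-1` B) = D B) &
      (forall B : 'I_n -> set T, (forall i, measurable (B i)) ->
         P (\bigcap_(i in [set: 'I_n]) (Z i @^-1` B i)) =
         (\prod_(i < n) P (Z i @^-1` B i))%E)].

End TRM.

(* Main.v *)
Require Import Defs.
From HB Require Import structures.
From mathcomp Require Import all_boot all_order all_algebra.
From mathcomp Require Import all_classical all_reals all_analysis.
From mathcomp Require Import measurable_realfun zify ring lra.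
Import Order.TTheory GRing.Theory Num.Theory.
Import numFieldNormedType.Exports.
Local Open Scope classical_set_scope.
Local Open Scope ring_scope.

(** The bound is a PAC-Bayes inequality in the transformation parameter combined
    with a union bound in the weights. The prior on transformations is Q_theta at
    alpha = A and pi = 1 - beta; with respect to it, the regularizer dominates the
    divergence of Q_theta, and the Donsker-Varadhan inequality can be checked one
    coordinate at a time. For a fixed weight, the prior mean of exp (sqrt n * gap)
    has expectation at most exp (2 (b - a)^2), by independence of the sample.
    Markov's inequality and a union bound over a net of mesh 1/n in the cube of
    half-width n * cutoff around w0 cost only O(log n) / sqrt n, and the Lipschitz
    assumption transfers the bound to all weights of the cube. Outside the cube
    the quadratic penalty already exceeds b - a. *)

(** * Means of bounded measurable functions *)

Section BoundedMeasurable.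
#[local] Set Implicit Arguments.
#[local] Unset Strict Implicit.
Context {R : realType}.

Definition bmfun {d} {T : measurableType d} (f : T -> R) :=
  measurable_fun setT f /\ exists M : R, forall x, `|f x| <= M.

Lemma bmfun_cst d (T : measurableType d) (c : R) : bmfun (fun _ : T => c).
Proof. by split; [exact: measurable_cst|exists `|c|]. Qed.

Lemma bmfun_comp d d' (T : measurableType d) (T' : measurableType d')
  (f : T' -> R) (g : T -> T') :
  measurable_fun setT g -> bmfun f -> bmfun (fun x => f (g x)).
Proof.
move=> mg [mf [M fM]]; split; last by exists M => x; exact: fM.
exact: (measurableT_comp mf mg).
Qed.

Lemma bmfunD d (T : measurableType d) (f g : T -> R) :
  bmfun f -> bmfun g -> bmfun (fun x => f x + g x).
Proof.
move=> [mf [M fM]] [mg [N gN]]; split; first exact: measurable_funD.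
by exists (M + N) => x; rewrite (le_trans (ler_normD _ _))// lerD.
Qed.

Lemma bmfunM d (T : measurableType d) (f g : T -> R) :
  bmfun f -> bmfun g -> bmfun (fun x => f x * g x).
Proof.
move=> [mf [M fM]] [mg [N gN]]; split; first exact: measurable_funM.
by exists (M * N) => x; rewrite normrM ler_pM.
Qed.

Lemma bmfunZ d (T : measurableType d) (c : R) (f : T -> R) :
  bmfun f -> bmfun (fun x => c * f x).
Proof. by move=> bf; apply: bmfunM => //; exact: bmfun_cst. Qed.

Lemma bmfunB d (T : measurableType d) (f g : T -> R) :
  bmfun f -> bmfun g -> bmfun (fun x => f x - g x).
Proof.
move=> bf bg; have := bmfunD bf (bmfunZ (-1) bg).
by congr bmfun; apply/funext => x /=; rewrite mulN1r.
Qed.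

Lemma bmfun_sum d (T : measurableType d) I (s : seq I) (f : I -> T -> R) :
  (forall i, bmfun (f i)) -> bmfun (fun x => \sum_(i <- s) f i x).
Proof.
move=> bf; elim: s => [|i s ih].
  by under eq_fun do rewrite big_nil; exact: bmfun_cst.
by under eq_fun do rewrite big_cons; exact: bmfunD.
Qed.

Lemma bmfun_expR d (T : measurableType d) (f : T -> R) :
  bmfun f -> bmfun (fun x => expR (f x)).
Proof.
move=> [mf [M fM]]; split; first exact: measurableT_comp.
exists (expR M) => x; rewrite ger0_norm ?expR_ge0// ler_expR.
by rewrite (le_trans (ler_norm _)).
Qed.

Lemma bmfun_ln d (T : measurableType d) (f : T -> R) (m : R) : 0 < m ->
  (forall x, m <= f x) -> bmfun f -> bmfun (fun x => ln (f x)).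
Proof.
move=> m0 mf [mef [M fM]]; split.
  by apply: measurableT_comp => //; exact: measurable_ln.
exists (Num.max `|ln m| `|ln M|) => x.
have fx0 : 0 < f x by exact: lt_le_trans (mf x).
have fxM : f x <= M by rewrite (le_trans (ler_norm _)).
have l1 : ln m <= ln (f x) by rewrite ler_ln ?posrE.
have l2 : ln (f x) <= ln M by rewrite ler_ln ?posrE// (lt_le_trans fx0).
rewrite le_max; case: (leP 0 (ln (f x))) => h.
  by rewrite ger0_norm// (le_trans l2 (ler_norm _)) orbT.
by rewrite ltr0_norm// -(normrN (ln m)) (le_trans _ (ler_norm _))// lerN2.
Qed.

Section mean.
Context d (T : measurableType d) (mu : probability T R).
Implicit Types f g : T -> R.

Lemma bmfun_integrable f : bmfun f -> mu.-integrable setT (EFin \o f).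
Proof.
move=> [mf [M fM]]; apply: measurable_bounded_integrable => //.
  by apply: le_lt_trans (probability_le1 _ _) _; rewrite ?ltry.
exists M; split; first exact: num_real.
by move=> x Mx y _ /=; exact: le_trans (fM y) (ltW Mx).
Qed.

Lemma mean_EFin f : bmfun f ->
  (\int[mu]_x (f x)%:E)%E = (Rintegral mu setT f)%:E.
Proof.
by move=> bf; rewrite /Rintegral fineK//; apply: integrable_fin_num => //;
  exact: bmfun_integrable.
Qed.

Lemma mean_cst c : Rintegral mu setT (fun _ => c) = c.
Proof.
rewrite Rintegral_cst//; have /= -> := @probability_setT _ _ _ mu.
by rewrite mulr1.
Qed.

Lemma meanD f g : bmfun f -> bmfun g ->
  Rintegral mu setT (fun x => f x + g x) =
  Rintegral mu setT f + Rintegral mu setT g.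
Proof. by move=> bf bg; rewrite RintegralD//; exact: bmfun_integrable. Qed.

Lemma meanB f g : bmfun f -> bmfun g ->
  Rintegral mu setT (fun x => f x - g x) =
  Rintegral mu setT f - Rintegral mu setT g.
Proof. by move=> bf bg; rewrite RintegralB//; exact: bmfun_integrable. Qed.

Lemma meanZ c f : bmfun f ->
  Rintegral mu setT (fun x => c * f x) = c * Rintegral mu setT f.
Proof. by move=> bf; rewrite RintegralZl//; exact: bmfun_integrable. Qed.

Lemma mean_sum I (s : seq I) (f : I -> T -> R) : (forall i, bmfun (f i)) ->
  Rintegral mu setT (fun x => \sum_(i <- s) f i x) =
  \sum_(i <- s) Rintegral mu setT (f i).
Proof.
move=> bf; elim: s => [|i s ih].
  by under eq_Rintegral do rewrite big_nil; rewrite mean_cst big_nil.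
under eq_Rintegral do rewrite big_cons.
by rewrite meanD ?ih ?big_cons//; exact: bmfun_sum.
Qed.

Lemma le_mean f g : bmfun f -> bmfun g -> (forall x, f x <= g x) ->
  Rintegral mu setT f <= Rintegral mu setT g.
Proof. by move=> bf bg fg; apply: le_Rintegral => //; exact: bmfun_integrable. Qed.

End mean.

Section fubini.
Context d1 d2 (T1 : measurableType d1) (T2 : measurableType d2).
Context (m1 : probability T1 R) (m2 : probability T2 R).

Lemma bmfun_fst (f : T1 * T2 -> R) y : bmfun f -> bmfun (fun x => f (x, y)).
Proof. by move=> bf; apply: bmfun_comp bf; exact: pair2_measurable. Qed.

Lemma bmfun_snd (f : T1 * T2 -> R) x : bmfun f -> bmfun (fun y => f (x, y)).
Proof. by move=> bf; apply: bmfun_comp bf; exact: pair1_measurable. Qed.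

Lemma bmfun_mean2 (f : T1 * T2 -> R) : bmfun f ->
  bmfun (fun x => Rintegral m2 setT (fun y => f (x, y))).
Proof.
move=> bf; have [_ [M fM]] := bf; split.
  have bfM : bmfun (fun z => f z + M) by apply: bmfunD => //; exact: bmfun_cst.
  have -> : (fun x => Rintegral m2 setT (fun y => f (x, y))) =
      (fun x => Rintegral m2 setT (fun y => f (x, y) + M) - M).
    apply/funext => x; rewrite meanD; [|exact: bmfun_snd|exact: bmfun_cst].
    by rewrite mean_cst addrK.
  apply: measurable_funB; last exact: measurable_cst.
  apply/measurable_EFinP.
  rewrite (_ : _ \o _ = fubini_F m2 (EFin \o (fun z => f z + M))).
    apply: measurable_fun_fubini_tonelli_F.
    - by apply/measurable_EFinP; case: bfM.
    - by move=> z; rewrite lee_fin; have := fM z; rewrite ler_norml => /andP[]; lra.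
  by apply/funext => x; rewrite /= /fubini_F -mean_EFin//; exact: (bmfun_snd x bfM).
exists M => x.
have b := bmfun_snd x bf; have c r := bmfun_cst T2 r.
rewrite ler_norml -{1}(mean_cst m2 (- M)) -{2}(mean_cst m2 M).
by rewrite !le_mean// => y; have := fM (x, y); rewrite ler_norml => /andP[].
Qed.

Lemma mean_fubini (f : T1 * T2 -> R) : bmfun f ->
  Rintegral m1 setT (fun x => Rintegral m2 setT (fun y => f (x, y))) =
  Rintegral (m1 \x m2)%E setT f.
Proof.
move=> bf; apply: EFin_inj; rewrite -!mean_EFin//; last exact: bmfun_mean2.
rewrite -[RHS]integral12_prod_meas1; last exact: bmfun_integrable.
by apply: eq_integral => x _; rewrite -mean_EFin//; exact: bmfun_snd.
Qed.

Lemma mean_fubini_sym (f : T1 * T2 -> R) : bmfun f ->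
  Rintegral m2 setT (fun y => Rintegral m1 setT (fun x => f (x, y))) =
  Rintegral (m1 \x m2)%E setT f.
Proof.
move=> bf; rewrite -mean_fubini// /Rintegral.
have h1 : (fun y => (fine (\int[m1]_x (f (x, y))%:E))%:E) =
    (fun y => \int[m1]_x (f (x, y))%:E)%E.
  by apply/funext => y; rewrite mean_EFin//; exact: bmfun_fst.
have h2 : (fun x => (fine (\int[m2]_y (f (x, y))%:E))%:E) =
    (fun x => \int[m2]_y (f (x, y))%:E)%E.
  by apply/funext => x; rewrite mean_EFin//; exact: bmfun_snd.
rewrite h1 h2; congr fine; apply/esym.
exact: (Fubini (f := EFin \o f)) (bmfun_integrable (m1 \x m2)%E bf).
Qed.

End fubini.
End BoundedMeasurable.

(** * The factors of Q_theta as probability measures *)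

Section Mixture.
Context {R : realType}.
#[local] Set Implicit Arguments.
#[local] Unset Strict Implicit.

Lemma mixture_prob d (T : measurableType d) (m : nat -> probability T R)
    (c : nat -> R) n : (forall j, 0 <= c j) -> \sum_(j < n) c j = 1 ->
  exists Q : probability T R, forall f, bmfun f ->
    Rintegral Q setT f = \sum_(j < n) c j * Rintegral (m j) setT f.
Proof.
move=> c0 c1.
pose ms j : {measure set T -> \bar R} := mscale (NngNum (c0 j)) (m j).
pose M : {measure set T -> \bar R} := msum ms n.
have intM f : bmfun f -> (forall x, 0 <= f x) ->
    (\int[M]_x (f x)%:E = (\sum_(j < n) c j * Rintegral (m j) setT f)%:E)%E.
  move=> bf f0; rewrite ge0_integral_measure_sum//.
  - rewrite -sumEFin; apply: eq_bigr => j _.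
    rewrite ge0_integral_mscale//; last by move=> x _; rewrite lee_fin.
      by rewrite mean_EFin.
    by apply/measurable_EFinP; case: bf.
  - by move=> x _; rewrite lee_fin.
  - by apply/measurable_EFinP; case: bf.
have MT : M setT = 1%E.
  rewrite -(mul1e (M setT)) -integral_cst// intM//; last exact: bmfun_cst.
  by under eq_bigr do rewrite mean_cst mulr1; rewrite c1.
pose HQ := Measure_isProbability.Build _ _ _ (msum ms n) MT.
pose Q : probability T R := HB.pack (msum ms n) HQ.
exists Q => f bf; have [_ [K fK]] := bf.
have bK := bmfun_cst T K.
have : Rintegral Q setT (fun x => f x + K) =
    \sum_(j < n) c j * Rintegral (m j) setT (fun x => f x + K).
  apply: EFin_inj; rewrite -mean_EFin; last exact: bmfunD.
  rewrite -intM//; first exact: bmfunD.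
  by move=> x; have := fK x; rewrite ler_norml => /andP[]; lra.
rewrite meanD// mean_cst.
under eq_bigr do rewrite meanD// mean_cst mulrDr.
by rewrite big_split/= -mulr_suml c1 mul1r => /addIr.
Qed.

Lemma mean_dirac d (T : measurableType d) (x : T) (f : T -> R) :
  bmfun f -> Rintegral (\d_x : probability T R) setT f = f x.
Proof.
move=> bf; rewrite /Rintegral integral_dirac//.
  by rewrite diracT mul1e.
by apply/measurable_EFinP; case: bf.
Qed.

Lemma mean_uniform (a b : R) (ab : a < b) (f : R -> R) : bmfun f ->
  Rintegral (uniform_prob ab) setT f =
  (b - a)^-1 * Rintegral lebesgue_measure `[a, b] f.
Proof.
move=> bf; have [mf [K fK]] := bf.
have bK := bmfun_cst R K.
have iab (g : R -> R) : bmfun g ->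
    lebesgue_measure.-integrable `[a, b] (EFin \o g).
  move=> [mg [M gM]]; apply: measurable_bounded_integrable => //.
  - by rewrite /= lebesgue_measure_itv/= lte_fin ab -EFinB ltry.
  - exact: measurable_funTS.
  exists M; split; first exact: num_real.
  by move=> x Mx y _ /=; exact: le_trans (gM y) (ltW Mx).
have : Rintegral (uniform_prob ab) setT (fun x => f x + K) =
   (b - a)^-1 * Rintegral lebesgue_measure `[a, b] (fun x => f x + K).
  rewrite {1}/Rintegral integral_uniform.
  - rewrite fineM//; exact: integrable_fin_num (iab _ (bmfunD bf bK)).
  - by apply/measurable_EFinP; case: (bmfunD bf bK).
  - by move=> x; have := fK x; rewrite lee_fin ler_norml => /andP[]; lra.
rewrite meanD// mean_cst RintegralD//; [|exact: iab..].
rewrite Rintegral_cst//= lebesgue_measure_itv/= lte_fin ab -EFinB/= mulrDr.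
by rewrite mulrCA mulVf ?mulr1; [move/addIr|rewrite subr_eq0 gt_eqF].
Qed.

Lemma pushforward_prob d d' (T : measurableType d) (T' : measurableType d')
    (mu : probability T R) (phi : T -> T') : measurable_fun setT phi ->
  exists nu : probability T' R, forall f, bmfun f ->
    Rintegral nu setT f = Rintegral mu setT (fun x => f (phi x)).
Proof.
move=> mphi.
pose F : {mfun T >-> T'} := HB.pack phi (isMeasurableFun.Build _ _ _ _ phi mphi).
exists (distribution mu F) => f bf; rewrite /Rintegral; congr fine.
have bfp : bmfun (fun x => f (phi x)) by exact: bmfun_comp bf.
rewrite /distribution integral_pushforward//.
- by apply/measurable_EFinP; case: bf.
- by rewrite preimage_setT; exact: bmfun_integrable.
Qed.

Section coord.
Context (K k : nat) (N : 'I_K -> nat) (alpha pi : 'I_K -> R).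
Hypothesis alpha_gt0 : forall i : 'I_K, (i < k)%N -> 0 < alpha i.
Hypothesis N_gt0 : forall i : 'I_K, (k <= i)%N -> (0 < N i)%N.
Hypothesis pi01 : forall i : 'I_K, 0 <= pi i <= 1.

Lemma coordE_mean (i : 'I_K) : exists Q : probability R R,
  forall G, bmfun G -> coordE k N alpha pi i G = Rintegral Q setT G.
Proof.
have /andP[p0 p1] := pi01 i.
rewrite /coordE; have [ik|ik] := boolP (i < k)%N.
  have a0 := alpha_gt0 ik; have aa : - alpha i < alpha i by lra.
  pose U : probability (measurableTypeR R) R := uniform_prob aa.
  pose m j :=
    if j is O then (\d_(0 : measurableTypeR R) : probability (measurableTypeR R) R)
    else U.
  pose c j := if j is O then 1 - pi i else pi i.
  have [|| Q HQ] := @mixture_prob _ _ m c 2.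
  - by case=> [|j] /=; lra.
  - by rewrite !big_ord_recl big_ord0 /=; lra.
  have [|Q' HQ'] := @pushforward_prob _ _ _ R Q idfun; first exact: measurable_id.
  exists Q' => G bG; rewrite HQ'// HQ// !big_ord_recl big_ord0 /= addr0.
  by rewrite mean_dirac// mean_uniform//; congr (_ + _ * (_^-1 * _)); lra.
rewrite -leqNgt in ik.
have NN : (N i)%:R != 0 :> R by rewrite pnatr_eq0 -lt0n N_gt0.
pose m j : probability R R :=
  if j is j'.+1 then (\d_(j'%:R : R) : probability R R)
  else (\d_(0 : R) : probability R R).
pose c j := if j is O then 1 - pi i else pi i * (N i)%:R^-1.
have [|| Q HQ] := @mixture_prob _ _ m c (N i).+1.
- by case=> [|j] /=; [lra|rewrite mulr_ge0// invr_ge0].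
- rewrite big_ord_recl /= sumr_const card_ord -[_ *+ N i]mulr_natr divfK//; lra.
exists Q => G bG; rewrite HQ// big_ord_recl /= mean_dirac//; congr (_ + _).
by rewrite mulrA mulr_sumr; apply: eq_bigr => j _; rewrite mean_dirac.
Qed.

End coord.
End Mixture.

(** * The Donsker-Varadhan inequality, coordinate by coordinate *)

Section DonskerVaradhan.
Context {R : realType}.
#[local] Set Implicit Arguments.
#[local] Unset Strict Implicit.

Lemma ln_le_sub1 (x : R) : 0 < x -> ln x <= x - 1.
Proof.
by move=> x0; have := expR_ge1Dx (ln x); rewrite lnK ?posrE//; lra.
Qed.

Lemma mul_ln_div_le (q r x : R) : 0 <= q -> 0 < r -> 0 < x ->
  q * ln x - q * ln (q / r) <= r * x - q.
Proof.
rewrite le_eqVlt => /predU1P[<-|q0] r0 x0.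
  by rewrite !mul0r !subr0 ltW// mulr_gt0.
have h : ln (x * r / q) <= x * r / q - 1.
  by apply: ln_le_sub1; rewrite !mulr_gt0// invr_gt0.
move: h; rewrite lnM ?posrE ?mulr_gt0 ?invr_gt0// lnM// ?posrE// lnV ?posrE//.
rewrite ln_div ?posrE// => h.
have : q * (ln x + ln r - ln q) <= q * (x * r / q - 1) by rewrite ler_pM2l.
have -> : q * (x * r / q - 1) = r * x - q by field; rewrite gt_eqF.
lra.
Qed.

(* Donsker-Varadhan for two-point distributions; apply [mul_ln_div_le] to both terms. *)
Lemma DV_bern (q r u v : R) : 0 <= q <= 1 -> 0 < r < 1 -> 0 < u -> 0 < v ->
  (1 - q) * ln u + q * ln v <= KLbern q r + ln ((1 - r) * u + r * v).
Proof.
move=> /andP[q0 q1] /andP[r0 r1] u0 v0; rewrite /KLbern.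
set S := (1 - r) * u + r * v.
have S0 : 0 < S by rewrite addr_gt0// mulr_gt0// subr_gt0.
have h1 : q * ln (v / S) - q * ln (q / r) <= r * (v / S) - q.
  by apply: mul_ln_div_le => //; rewrite divr_gt0.
have h2 : (1 - q) * ln (u / S) - (1 - q) * ln ((1 - q) / (1 - r))
    <= (1 - r) * (u / S) - (1 - q).
  by apply: mul_ln_div_le; [rewrite subr_ge0|rewrite subr_gt0|exact: divr_gt0].
have h3 : r * (v / S) + (1 - r) * (u / S) = 1.
  by rewrite /S; field; rewrite gt_eqF.
move: h1 h2; rewrite (@ln_div _ v S) ?posrE// (@ln_div _ u S) ?posrE//; lra.
Qed.

Lemma mean_ge d (T : measurableType d) (mu : probability T R) (f : T -> R) c :
  bmfun f -> (forall x, c <= f x) -> c <= Rintegral mu setT f.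
Proof.
by move=> bf cf; rewrite -(mean_cst mu c); apply: le_mean => //; exact: bmfun_cst.
Qed.

Lemma mean_ln_le d (T : measurableType d) (mu : probability T R) (f : T -> R) m :
  0 < m -> (forall x, m <= f x) -> bmfun f ->
  Rintegral mu setT (fun x => ln (f x)) <= ln (Rintegral mu setT f).
Proof.
move=> m0 mf bf; set c := Rintegral mu setT f.
have c0 : 0 < c by apply: lt_le_trans m0 _; exact: mean_ge.
have -> : ln c = Rintegral mu setT (fun x => ln c - 1 + c^-1 * f x).
  rewrite meanD; [|exact: bmfun_cst|exact: bmfunZ].
  by rewrite mean_cst meanZ// -/c mulVf ?gt_eqF//; ring.
apply: le_mean.
- exact: bmfun_ln m0 mf bf.
- by apply: bmfunD; [exact: bmfun_cst|exact: bmfunZ].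
move=> x; have fx0 : 0 < f x by exact: lt_le_trans (mf x).
have := @ln_le_sub1 (f x / c); rewrite divr_gt0// ln_div ?posrE// => /(_ isT).
lra.
Qed.

Lemma Rintegral_subset_le (a b c e : R) (f : R -> R) : c <= a -> b <= e ->
  bmfun f -> (forall x, 0 <= f x) ->
  Rintegral lebesgue_measure `[a, b] f <= Rintegral lebesgue_measure `[c, e] f.
Proof.
move=> ca be [mf [M fM]] f0.
have i x y : (\int[lebesgue_measure]_(t in `[x, y]) (f t)%:E)%E \is a fin_num.
  apply: integrable_fin_num => //.
  apply: measurable_bounded_integrable => //.
  - by rewrite /= lebesgue_measure_itv; case: ifP => _; rewrite -?EFinB ltry.
  - exact: measurable_funTS.
  exists M; split; first exact: num_real.
  by move=> z Mz t _ /=; exact: le_trans (fM t) (ltW Mz).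
apply: fine_le => //; apply: ge0_subset_integral => //.
- by apply/measurable_EFinP; exact: measurable_funTS.
- by move=> x _; rewrite lee_fin.
- by move=> x /=; rewrite !in_itv/= => /andP[ax xb]; apply/andP; split; lra.
Qed.

Section coord.
Context (K k : nat) (N : 'I_K -> nat) (A alpha pi : 'I_K -> R) (beta : R).
Hypothesis beta01 : 0 < beta < 1.
Hypothesis alphaA : forall i : 'I_K, (i < k)%N -> 0 < alpha i <= A i.
Hypothesis N_ge2 : forall i : 'I_K, (k <= i)%N -> (2 <= N i)%N.
Hypothesis pi01 : forall i : 'I_K, 0 <= pi i <= 1.

Definition coordKL (i : 'I_K) : R :=
  if (i < k)%N then KLbern (pi i) (1 - beta) + pi i * KLunif (alpha i) (A i)
  else KLbern ((1 - (N i)%:R^-1) * pi i) ((1 - (N i)%:R^-1) * (1 - beta)).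

(* The divergence splits off the atom at 0; in the continuous case the uniform
   part loses the factor [A i / alpha i] when [-alpha i, alpha i] is enlarged to
   [-A i, A i], in the discrete case the rest is uniform on the nonzero values. *)
Lemma DV_coordE (i : 'I_K) (H : R -> R) (m : R) :
  0 < m -> (forall x, m <= H x) -> bmfun H ->
  coordE k N alpha pi i (fun t => ln (H t)) <=
  coordKL i + ln (coordE k N A (fun _ => 1 - beta) i H).
Proof.
move=> m0 mH bH; have /andP[b0 b1] := beta01.
have H0 x : 0 < H x by exact: lt_le_trans (mH x).
have b1' : 0 < 1 - beta < 1 by apply/andP; split; lra.
rewrite /coordE /coordKL; have [ik|ik] := boolP (i < k)%N.
  have /andP[a0 aA] := alphaA ik.
  have A0 : 0 < A i by lra.
  have aa : - alpha i < alpha i by lra.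
  have AA : - A i < A i by lra.
  have -> : 2 * alpha i = alpha i - - alpha i by ring.
  have -> : 2 * A i = A i - - A i by ring.
  rewrite -!(@mean_uniform _ _ _ aa); last exact: bmfun_ln m0 mH bH.
  rewrite -(@mean_uniform _ _ _ AA)//.
  set V := Rintegral (uniform_prob AA) setT H.
  have V0 : 0 < V by apply: lt_le_trans m0 _; exact: mean_ge.
  have le1 := @mean_ln_le _ _ (uniform_prob aa) H m m0 mH bH.
  have v0 : 0 < Rintegral (uniform_prob aa) setT H.
    by apply: lt_le_trans m0 _; exact: mean_ge.
  have le2 : Rintegral (uniform_prob aa) setT H <= (A i / alpha i) * V.
    rewrite /V !mean_uniform//.
    have : Rintegral lebesgue_measure `[- alpha i, alpha i] H <=
           Rintegral lebesgue_measure `[- A i, A i] H.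
      by apply: Rintegral_subset_le => //; [lra|move=> x; exact: ltW].
    set x := Rintegral _ _ _; set y := Rintegral _ _ _ => xy.
    have -> : A i / alpha i * ((A i - - A i)^-1 * y) = (alpha i - - alpha i)^-1 * y.
      by field; rewrite !subr_eq0 !gt_eqF.
    by rewrite ler_pM2l// invr_gt0; lra.
  have le3 : ln (Rintegral (uniform_prob aa) setT H) <= ln (A i / alpha i) + ln V.
    have AV : 0 < A i / alpha i by exact: divr_gt0.
    rewrite -lnM; [|exact: AV|exact: V0].
    by rewrite ler_ln; [|exact: v0|exact: mulr_gt0].
  have /andP[p0 p1] := pi01 i.
  have D := @DV_bern _ _ _ _ (pi01 i) b1' (H0 0) V0.
  have J : pi i * Rintegral (uniform_prob aa) setT (fun x => ln (H x)) <=
         pi i * (ln (A i / alpha i) + ln V).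
    by rewrite ler_wpM2l// (le_trans le1).
  rewrite /KLunif; move: D J; clearbody V; clear le1 le2 le3 v0.
  move: (Rintegral _ _ _) => I1; lra.
rewrite -leqNgt in ik.
have /andP[p0 p1] := pi01 i.
move: (N_ge2 ik); case: (N i) => [//|[//|n]] _.
rewrite !(big_ord_recl n.+1) /=.
set q := (1 - n.+2%:R^-1) * pi i; set r := (1 - n.+2%:R^-1) * (1 - beta).
have n0 : (0 : R) < n.+1%:R by rewrite ltr0n.
have nS : n.+2%:R = n.+1%:R + 1 :> R by rewrite -natr1.
set V := n.+1%:R^-1 * \sum_(j < n.+1) H (bump 0 j)%:R.
have V0 : 0 < V.
  rewrite mulr_gt0 ?invr_gt0// big_ord_recl ltr_pwDl//.
  by apply: sumr_ge0 => j _; exact: ltW.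
have lnV_ge : n.+1%:R^-1 * \sum_(j < n.+1) ln (H (bump 0 j)%:R) <= ln V.
  rewrite mulrC ler_pdivrMr//.
  have -> : ln V * n.+1%:R = \sum_(j < n.+1) (ln V - 1 + V^-1 * H (bump 0 j)%:R).
    rewrite big_split/= sumr_const card_ord -mulr_sumr -[_ *+ n.+1]mulr_natr.
    have -> : \sum_(j < n.+1) H (bump 0 j)%:R = n.+1%:R * V.
      by rewrite /V mulrA mulfV ?mul1r// gt_eqF.
    by rewrite [V^-1 * _]mulrCA mulVf ?gt_eqF//; ring.
  apply: ler_sum => j _; have Hj := H0 (bump 0 j)%:R.
  have := @ln_le_sub1 (H (bump 0 j)%:R / V).
  by rewrite divr_gt0// ln_div ?posrE// => /(_ isT); lra.
have t01 : 0 < (1 - n.+2%:R^-1 : R) < 1.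
  rewrite nS; apply/andP; split.
    by rewrite subr_gt0 invf_lt1//; lra.
  by rewrite ltrBlDr ltrDl invr_gt0; lra.
have [t0 t1] := andP t01.
have q01 : 0 <= q <= 1 by rewrite mulr_ge0 ?mulr_ile1// ltW.
have r01 : 0 < r < 1.
  by have [c0 c1] := andP b1'; rewrite mulr_gt0 ?mulr_ilt1// ltW.
have mixE (c x y : R) : (1 - c) * x + c * (n.+2%:R^-1 * (x + y)) =
    (1 - (1 - n.+2%:R^-1) * c) * x + (1 - n.+2%:R^-1) * c * (n.+1%:R^-1 * y).
  by rewrite nS; field; rewrite !gt_eqF// addr_gt0.
rewrite !mixE; apply: le_trans (@DV_bern _ _ _ _ q01 r01 (H0 0) V0).
by rewrite lerD2l ler_wpM2l//; case/andP: q01.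
Qed.

Lemma measurable_tupset (i : 'I_K) :
  measurable_fun setT (fun ra : R * K.-tuple R => tupset ra.2 i ra.1).
Proof.
apply/measurable_fun_tnthP => j.
have [ij|ij] := eqVneq j i.
  by rewrite (_ : _ \o _ = fst)//; apply/funext => -[r a] /=;
    rewrite tnth_mktuple ij eqxx.
rewrite (_ : _ \o _ = (@tnth K R ^~ j) \o snd); last first.
  by apply/funext => -[r a] /=; rewrite tnth_mktuple (negbTE ij).
by apply: measurableT_comp => //; exact: measurable_tnth.
Qed.

Lemma QE_rec_mean (al : 'I_K -> R) (pr : 'I_K -> R) (ixs : seq 'I_K) :
  (forall i : 'I_K, (i < k)%N -> 0 < al i) ->
  (forall i, 0 <= pr i <= 1) ->
  exists d (T : measurableType d) (mu : probability T R)
    (phi : T * K.-tuple R -> K.-tuple R), measurable_fun setT phi /\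
  forall F, bmfun F -> forall a,
    QE_rec k N al pr ixs F a = Rintegral mu setT (fun t => F (phi (t, a))).
Proof.
move=> al0 pr01; elim: ixs => [|i ixs [d [T [mu [phi [mphi IH]]]]]].
  exists _, unit, (\d_tt : probability unit R), snd; split=> // F bF a /=.
  by rewrite mean_cst.
have N0 (j : 'I_K) : (k <= j)%N -> (0 < N j)%N by move=> /N_ge2; exact: ltnW.
have [Q HQ] := @coordE_mean _ _ _ N _ _ al0 N0 pr01 i.
pose psi (rta : (R * T) * K.-tuple R) := phi (rta.1.2, tupset rta.2 i rta.1.1).
have mpsi : measurable_fun setT psi.
  apply: measurableT_comp mphi _; apply/measurable_fun_pair => /=.
    exact: measurableT_comp.
  apply: (measurableT_comp (measurable_tupset i)
    (g := fun rta : (R * T) * K.-tuple R => (rta.1.1, rta.2))).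
  by apply/measurable_fun_pair => //=; exact: measurableT_comp.
exists _, (R * T)%type, (Q \x mu)%E, psi; split=> // F bF a /=.
have bG : bmfun (fun rt : R * T => F (psi (rt, a))).
  by apply: bmfun_comp bF; exact: measurableT_comp mpsi (pair2_measurable a).
rewrite -mean_fubini// HQ; last first.
  have := @bmfun_mean2 _ _ _ _ _ mu _ bG.
  by congr bmfun; apply/funext => r; rewrite IH.
by congr Rintegral; apply/funext => r; rewrite IH.
Qed.

End coord.
End DonskerVaradhan.

Section QE.
Context {R : realType}.
#[local] Set Implicit Arguments.
#[local] Unset Strict Implicit.
Context (K k : nat) (N : 'I_K -> nat) (A : 'I_K -> R) (beta : R).
Hypothesis beta01 : 0 < beta < 1.
Hypothesis A_gt0 : forall i : 'I_K, (i < k)%N -> 0 < A i.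
Hypothesis N_ge2 : forall i : 'I_K, (k <= i)%N -> (2 <= N i)%N.

Section theta.
Context (alpha pi : 'I_K -> R).
Hypothesis alphaA : forall i : 'I_K, (i < k)%N -> 0 < alpha i <= A i.
Hypothesis pi01 : forall i : 'I_K, 0 <= pi i <= 1.

Let alpha_gt0 : forall i : 'I_K, (i < k)%N -> 0 < alpha i.
Proof. by move=> i /alphaA/andP[]. Qed.

Let N_gt0 (i : 'I_K) : (k <= i)%N -> (0 < N i)%N.
Proof. by move=> /N_ge2; exact: ltnW. Qed.

Let prior01 : forall i : 'I_K, 0 <= 1 - beta <= 1.
Proof. by move=> _; have /andP[] := beta01; lra. Qed.

Lemma QE_mean : exists nu : probability (K.-tuple R) R,
  forall F, bmfun F -> QE k N alpha pi F = Rintegral nu setT F.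
Proof.
have [d [T [mu [phi [mphi HQ]]]]] :=
  @QE_rec_mean R K k N N_ge2 alpha pi (enum 'I_K) alpha_gt0 pi01.
pose phi0 t := phi (t, [tuple (0 : R) | _ < K]).
have mphi0 : measurable_fun setT phi0.
  exact: measurableT_comp mphi (pair2_measurable _).
have [nu Hnu] := pushforward_prob mu mphi0.
by exists nu => F bF; rewrite /QE HQ// Hnu.
Qed.

Lemma DV_QE_rec (ixs : seq 'I_K) F a : bmfun F ->
  QE_rec k N alpha pi ixs F a <= \sum_(i <- ixs) coordKL k N A alpha pi beta i +
    ln (QE_rec k N A (fun _ => 1 - beta) ixs (fun a => expR (F a)) a).
Proof.
move=> bF; elim: ixs a => [|i ixs IH] a /=.
  by rewrite big_nil add0r expRK.
rewrite big_cons.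
have [_ [M FM]] := bF.
have [Q HQ] := @coordE_mean _ _ _ N _ _ alpha_gt0 N_gt0 pi01 i.
have [d [T [mu [phi [mphi Hphi]]]]] :=
  @QE_rec_mean R K k N N_ge2 alpha pi ixs alpha_gt0 pi01.
have [d' [T' [mu' [phi' [mphi' Hphi']]]]] :=
  @QE_rec_mean R K k N N_ge2 A (fun _ => 1 - beta) ixs A_gt0 prior01.
pose G t := QE_rec k N alpha pi ixs F (tupset a i t).
pose H t := QE_rec k N A (fun _ => 1 - beta) ixs (fun a => expR (F a)) (tupset a i t).
have mtup d1 (T1 : measurableType d1) : measurable_fun setT
    (fun rt : R * T1 => (rt.2, tupset a i rt.1)).
  apply/measurable_fun_pair => //=.
  apply: (measurableT_comp (measurable_tupset i) (g := fun rt : R * T1 => (rt.1, a))).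
  by apply/measurable_fun_pair => //=; exact: measurable_cst.
have bG : bmfun G.
  rewrite (_ : G = fun r => Rintegral mu setT (fun t => F (phi (t, tupset a i r)))).
    apply: (@bmfun_mean2 _ _ _ _ _ mu (fun rt => F (phi (rt.2, tupset a i rt.1)))).
    by apply: bmfun_comp bF; exact: measurableT_comp mphi (mtup _ _).
  by apply/funext => r; rewrite /G Hphi.
have beF := bmfun_expR bF.
have bH : bmfun H.
  rewrite (_ : H = fun r => Rintegral mu' setT (fun t => expR (F (phi' (t, tupset a i r))))).
    apply: (@bmfun_mean2 _ _ _ _ _ mu' (fun rt => expR (F (phi' (rt.2, tupset a i rt.1))))).
    by apply: bmfun_comp beF; exact: measurableT_comp mphi' (mtup _ _).
  by apply/funext => r; rewrite /H Hphi'.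
have mH t : expR (- M) <= H t.
  rewrite /H Hphi'//; apply: mean_ge.
    apply: bmfun_comp beF; exact: measurableT_comp mphi' (pair2_measurable _).
  by move=> x; rewrite ler_expR; have := FM (phi' (x, tupset a i t));
    rewrite ler_norml => /andP[].
have bln : bmfun (fun t => ln (H t)) by exact: bmfun_ln (expR_gt0 _) mH bH.
apply: (@le_trans _ _ (\sum_(j <- ixs) coordKL k N A alpha pi beta j +
    coordE k N alpha pi i (fun t => ln (H t)))).
  rewrite !HQ// -[X in _ <= X + _](mean_cst Q) -meanD//; last exact: bmfun_cst.
  by apply: le_mean => //; apply: bmfunD => //; exact: bmfun_cst.
rewrite -[leRHS]addrA [leRHS]addrCA lerD2l.
exact: (@DV_coordE R K k N A alpha pi beta beta01 alphaA N_ge2 pi01 i H _ (expR_gt0 _) mH bH).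
Qed.

Lemma DV_QE F : bmfun F ->
  QE k N alpha pi F <= Reg k A N beta alpha pi +
    ln (QE k N A (fun _ => 1 - beta) (fun a => expR (F a))).
Proof.
move=> bF; apply: le_trans (DV_QE_rec _ _ bF) _.
by rewrite /Reg big_enum.
Qed.

Lemma QE_rec_eq (F F' : K.-tuple R -> R) ixs a : Aset k A N a ->
  (forall a, Aset k A N a -> F a = F' a) ->
  QE_rec k N alpha pi ixs F a = QE_rec k N alpha pi ixs F' a.
Proof.
move=> Aa FF'; elim: ixs a Aa => [|i ixs IH] a Aa /=; first exact: FF'.
have tA t : ((i < k)%N -> - A i <= t <= A i) ->
    (~~ (i < k)%N -> exists2 j : nat, (j < N i)%N & t = j%:R) ->
    Aset k A N (tupset a i t).
  move=> h1 h2 j; rewrite tnth_mktuple.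
  by case: eqVneq => [->|_]; [split|exact: Aa].
rewrite /coordE; have [ik|ik] := boolP (i < k)%N.
  have /andP[a0 aA] := alphaA ik.
  rewrite IH; last by apply: tA; rewrite ik// => _; lra.
  congr (_ + _ * (_ * _)); apply: eq_Rintegral => t.
  rewrite inE/= in_itv/= => /andP[t1 t2].
  by rewrite IH//; apply: tA; rewrite ik// => _; lra.
have ki : (k <= i)%N by rewrite leqNgt.
rewrite IH; last first.
  by apply: tA; rewrite ?(negbTE ik)// => _; exists 0%N => //; exact: N_gt0.
congr (_ + _ * (_ * _)); apply: eq_bigr => j _.
by rewrite IH//; apply: tA; rewrite ?(negbTE ik)// => _; exists j.
Qed.

End theta.

Lemma Aset0 : Aset k A N [tuple (0 : R) | _ < K].
Proof.
move=> i; rewrite tnth_mktuple; split => ik.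
  by have := A_gt0 ik; lra.
by exists 0%N => //; apply/ltnW/N_ge2; rewrite leqNgt.
Qed.

Lemma measurable_Aset : measurable (Aset k A N : set (K.-tuple R)).
Proof.
pose B (i : 'I_K) : set R := if (i < k)%N then `[- A i, A i]%classic
  else \bigcup_(j in [set j : nat | (j < N i)%N]) [set j%:R].
rewrite (_ : Aset k A N = \bigcap_(i in [set: 'I_K]) ((@tnth K R ^~ i) @^-1` B i)).
  apply: fin_bigcap_measurable => // i _.
  rewrite -[X in measurable X]setTI; apply: measurable_tnth => //.
  rewrite /B; case: ifP => _ //; apply: bigcup_measurable => j _; exact: measurable_set1.
rewrite /B; apply/seteqP; split => a Aa i.
  move=> _ /=; have [h1 h2] := Aa i.
  have [ik|ik] := boolP (i < k)%N; first by rewrite /= in_itv/=; exact: h1.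
  by have [j jN aj] := h2 ik; exists j.
have := Aa i I => /=; have [ik|ik] := boolP (i < k)%N.
  by rewrite /= in_itv/=.
by move=> [j jN aj]; split => // _; exists j.
Qed.

(* Losses are only assumed measurable for parameters in [Aset]; precomposing them
   with this retraction makes them globally measurable without changing [QE]. *)
Definition retractA (a : K.-tuple R) : K.-tuple R :=
  if a \in Aset k A N then a else [tuple (0 : R) | _ < K].

Lemma retractA_in a : Aset k A N (retractA a).
Proof. by rewrite /retractA; case: ifPn => [/set_mem//|_]; exact: Aset0. Qed.

Lemma retractA_id a : Aset k A N a -> retractA a = a.
Proof. by move=> /mem_set; rewrite /retractA => ->. Qed.

Lemma measurable_retractA : measurable_fun setT retractA.
Proof.
apply: measurable_fun_if => //.
- apply: (@measurable_fun_bool _ _ _ _ true).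
  rewrite (_ : _ @^-1` _ = Aset k A N); first by rewrite setTI; exact: measurable_Aset.
  by apply/seteqP; split => a /=; [move/set_mem|move/mem_set].
Qed.

Lemma QE_retract (alpha pi : 'I_K -> R) F :
  (forall i : 'I_K, (i < k)%N -> 0 < alpha i <= A i) ->
  QE k N alpha pi F = QE k N alpha pi (fun a => F (retractA a)).
Proof.
move=> alphaA; apply: QE_rec_eq => //; first exact: Aset0.
by move=> a /retractA_id ->.
Qed.

(* [DV_QE] at [F = 0]. *)
Lemma Reg_ge0 (alpha pi : 'I_K -> R) :
  (forall i : 'I_K, (i < k)%N -> 0 < alpha i <= A i) ->
  (forall i : 'I_K, 0 <= pi i <= 1) -> 0 <= Reg k A N beta alpha pi.
Proof.
move=> alphaA pi01.
have AA (i : 'I_K) : (i < k)%N -> 0 < A i <= A i by move=> /A_gt0 ->; rewrite lexx.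
have p01 (i : 'I_K) : 0 <= 1 - beta <= 1 by have /andP[] := beta01; lra.
have b0 := @bmfun_cst R _ (K.-tuple R) 0.
have b1 := @bmfun_cst R _ (K.-tuple R) 1.
have := @DV_QE alpha pi alphaA pi01 _ b0.
have [nu ->//] := @QE_mean alpha pi alphaA pi01.
have [nu' ->] := @QE_mean A (fun _ => 1 - beta) AA p01.
  by rewrite expR0 !mean_cst ln1 addr0.
by rewrite expR0.
Qed.

End QE.

(** * Exponential moments of independent samples *)

Section Concentration.
Context {R : realType}.
#[local] Set Implicit Arguments.
#[local] Unset Strict Implicit.

Lemma expR_le_quadratic (x : R) : x <= 1 -> expR x <= 1 + x + 2 * x ^+ 2.
Proof.
move=> x1.
have h1 : 1 - x / 2 <= expR (- (x / 2)) by have := expR_ge1Dx (- (x / 2)).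
have h0 : 0 < 1 - x / 2 by lra.
have h2 : (1 - x / 2) ^+ 2 <= expR (- x).
  have -> : - x = - (x / 2) + - (x / 2) by field.
  by rewrite expRD -expr2 lerXn2r ?nnegrE ?expR_ge0// ltW.
have h3 : 0 <= 1 + x + 2 * x ^+ 2 by nra.
have h4 : 1 <= (1 + x + 2 * x ^+ 2) * (1 - x / 2) ^+ 2.
  have -> : (1 + x + 2 * x ^+ 2) * (1 - x / 2) ^+ 2 =
     1 + x ^+ 2 / 4 * ((1 - x) * (5 - 2 * x)) by field.
  rewrite lerDl; apply: mulr_ge0; first by rewrite divr_ge0// sqr_ge0.
  by apply: mulr_ge0; lra.
have h5 : 1 <= (1 + x + 2 * x ^+ 2) * expR (- x).
  by rewrite (le_trans h4)// ler_wpM2l.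
by move: h5; rewrite expRN ler_pdivlMr ?expR_gt0// mul1r.
Qed.

Lemma expR_le_add_expR_sqr (x : R) : expR x <= x + expR (2 * x ^+ 2).
Proof.
have [x1|x1] := leP x 1.
  rewrite (le_trans (expR_le_quadratic x1))//.
  by have := expR_ge1Dx (2 * x ^+ 2); lra.
have : expR x <= expR (2 * x ^+ 2) by rewrite ler_expR; nra.
lra.
Qed.

Lemma mean_expR_centered d (T : measurableType d) (mu : probability T R)
    (f : T -> R) (a b t : R) : bmfun f -> (forall x, a <= f x <= b) ->
  Rintegral mu setT (fun x => expR (t * (Rintegral mu setT f - f x))) <=
  expR (2 * (t * (b - a)) ^+ 2).
Proof.
move=> bf fab; set m := Rintegral mu setT f.
have am : a <= m by apply: mean_ge => // x; case/andP: (fab x).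
have mb : m <= b.
  rewrite -(mean_cst mu b); apply: le_mean => //; first exact: bmfun_cst.
  by move=> x; case/andP: (fab x).
have bm : bmfun (fun x => t * (m - f x)).
  by apply: bmfunZ; apply: bmfunB => //; exact: bmfun_cst.
set C := expR _.
have -> : C = Rintegral mu setT (fun x => t * (m - f x) + C).
  rewrite meanD//; last exact: bmfun_cst.
  rewrite mean_cst meanZ; last by apply: bmfunB => //; exact: bmfun_cst.
  by rewrite meanB ?mean_cst ?subrr ?mulr0 ?add0r//; exact: bmfun_cst.
apply: le_mean; [exact: bmfun_expR|by apply: bmfunD => //; exact: bmfun_cst|].
move=> x; rewrite (le_trans (expR_le_add_expR_sqr _))// lerD2l ler_expR.
rewrite ler_pM2l// !exprMn ler_wpM2l ?sqr_ge0//.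
have /andP[fa fb] := fab x.
have [h1 h2] : a - b <= m - f x /\ m - f x <= b - a by split; lra.
by clear fab am mb; nra.
Qed.

Lemma sum_ltn_indicator (m t : nat) : (t <= m)%N ->
  \sum_(j < m) (j < t)%:R = t%:R :> R.
Proof.
move=> tm; suff -> : \sum_(j < m) (j < t)%:R = (minn m t)%:R :> R.
  by rewrite (minn_idPr tm).
elim: m {tm} => [|m ih]; first by rewrite big_ord0 min0n.
rewrite big_ord_recr /= {}ih -natrD; congr (_%:R); rewrite /minn.
by case: (ltnP m t) => ?; case: (ltnP m.+1 t) => ? /=; lia.
Qed.

Lemma bmfun_indic d (T : measurableType d) (B : set T) : measurable B ->
  bmfun (\1_B : T -> R).
Proof.
move=> mB; split; first exact: measurable_indic.
by exists 1 => x; rewrite indicE; case: (_ \in _); rewrite ?normr1 ?normr0.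
Qed.

(* A nonnegative bounded g is within 1/k of the layer sum of the functions
   [k^-1 * \1_(g >= (j+1)/k)]. *)
Lemma bounded_linear_eq0 d (T : measurableType d) (Phi : (T -> R) -> R) (C : R) :
  (forall f g, bmfun f -> bmfun g ->
     Phi (fun x => f x + g x) = Phi f + Phi g) ->
  (forall c f, bmfun f -> Phi (fun x => c * f x) = c * Phi f) ->
  (forall f e, bmfun f -> (forall x, `|f x| <= e) -> `|Phi f| <= C * e) ->
  (forall B, measurable B -> Phi (\1_B) = 0) ->
  forall g, bmfun g -> Phi g = 0.
Proof.
move=> PD PZ Pb P1.
have Psum I (s : seq I) (f : I -> T -> R) : (forall i, bmfun (f i)) ->
    Phi (fun x => \sum_(i <- s) f i x) = \sum_(i <- s) Phi (f i).
  move=> bf; elim: s => [|i s ih].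
    have -> : (fun x : T => \sum_(i <- [::]) f i x) = (fun x => 0 * \1_setT x).
      by apply/funext => x; rewrite big_nil mul0r.
    by rewrite PZ ?P1 ?mulr0 ?big_nil//; exact: bmfun_indic.
  under eq_fun do rewrite big_cons.
  by rewrite PD ?ih ?big_cons//; exact: bmfun_sum.
suff P0 g : bmfun g -> (forall x, 0 <= g x) -> Phi g = 0.
  move=> g bg; have [_ [M gM]] := bg.
  have b1 : bmfun (fun x : T => M * \1_setT x) by apply: bmfunZ; exact: bmfun_indic.
  have : Phi (fun x => g x + M * \1_setT x) = 0.
    apply: P0; first exact: bmfunD.
    by move=> x; rewrite indicT mulr1; have := gM x; rewrite ler_norml => /andP[]; lra.
  rewrite PD// PZ ?P1 ?mulr0 ?addr0//; exact: bmfun_indic.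
move=> bg g0; have [mg [M gM]] := bg.
suff Pk k : `|Phi g| <= C * k.+1%:R^-1.
  apply/eqP; rewrite -normr_le0; apply/ler_addgt0Pr => e e0; rewrite add0r.
  have C0 : 0 <= C.
    have := Pk 0%N; rewrite invr1 mulr1; exact: le_trans.
  pose k := Num.truncn (C / e).
  apply: le_trans (Pk k) _; rewrite ler_pdivrMr// mulrC -ler_pdivrMr//.
  by apply/ltW; exact: truncnS_gt.
pose m := Num.truncn (k.+1%:R * M).
pose L j : set T := [set x | j.+1%:R <= k.+1%:R * g x].
have mL j : measurable (L j).
  rewrite /L -[X in measurable X]setTI.
  have mkg : measurable_fun setT (fun x => k.+1%:R * g x).
    by apply: measurable_funM => //; exact: measurable_cst.
  have := mkg measurableT _ (measurable_itv `[j.+1%:R, +oo[).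
  by congr measurable; apply/seteqP; split=> x /=; rewrite in_itv/= andbT.
pose gk (x : T) : R := k.+1%:R^-1 * \sum_(j < m) \1_(L j) x.
have k0 : 0 < k.+1%:R :> R by rewrite ltr0n.
have gkE x : gk x = k.+1%:R^-1 * (Num.truncn (k.+1%:R * g x))%:R.
  congr (_ * _); rewrite -(@sum_ltn_indicator m (Num.truncn (k.+1%:R * g x))); last first.
    by apply: le_truncn; rewrite ler_pM2l// (le_trans (ler_norm _)).
  apply: eq_bigr => j _; rewrite indicE; congr (_%:R); congr nat_of_bool.
  rewrite [RHS](_ : _ = (j.+1%:R <= k.+1%:R * g x)).
    by apply/idP/idP => [/set_mem//|h]; exact: mem_set.
  by rewrite truncn_gt_nat.
have bgk : bmfun gk.
  by apply: bmfunZ; apply: bmfun_sum => j; exact: bmfun_indic.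
have Pgk : Phi gk = 0.
  rewrite PZ; last by apply: bmfun_sum => j; exact: bmfun_indic.
  rewrite Psum; last by move=> j; exact: bmfun_indic.
  by rewrite big1 ?mulr0// => j _; exact: P1.
have -> : Phi g = Phi (fun x => g x - gk x).
  have b' := bmfunZ (-1) bgk.
  have -> : (fun x => g x - gk x) = (fun x => g x + (-1) * gk x).
    by apply/funext => x; rewrite mulN1r.
  by rewrite PD// PZ// Pgk mulr0 addr0.
apply: Pb; first exact: bmfunB.
move=> x; rewrite gkE.
have gx0 : 0 <= k.+1%:R * g x by rewrite mulr_ge0.
have /andP[t1 t2] := truncn_itv gx0.
have -> : g x = k.+1%:R^-1 * (k.+1%:R * g x) by rewrite mulrA mulVf ?mul1r// gt_eqF.
rewrite [k.+1%:R * (_ * _)]mulrA mulfV ?mul1r ?gt_eqF//.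
rewrite -mulrBr normrM gtr0_norm ?invr_gt0// ler_piMr ?invr_ge0 ?ltW//.
rewrite ger0_norm ?subr_ge0//.
by move: t2; rewrite -natr1; lra.
Qed.

End Concentration.

Section Independence.
Context {R : realType}.
#[local] Set Implicit Arguments.
#[local] Unset Strict Implicit.

Lemma bmfun_prod d (T : measurableType d) I (s : seq I) (Q : pred I) (f : I -> T -> R) :
  (forall i, bmfun (f i)) -> bmfun (fun x => \prod_(i <- s | Q i) f i x).
Proof.
move=> bf; elim: s => [|i s ih].
  by under eq_fun do rewrite big_nil; exact: bmfun_cst.
under eq_fun do rewrite big_cons.
by case: (Q i) => //; exact: bmfunM.
Qed.

Lemma norm_mean_le d (T : measurableType d) (mu : probability T R) (f : T -> R) (e : R) :
  bmfun f -> (forall x, `|f x| <= e) -> `|Rintegral mu setT f| <= e.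
Proof.
move=> bf fe; rewrite ler_norml; apply/andP; split.
  by apply: mean_ge => // x; have := fe x; rewrite ler_norml => /andP[].
rewrite -(mean_cst mu e); apply: le_mean => //; first exact: bmfun_cst.
by move=> x; have := fe x; rewrite ler_norml => /andP[].
Qed.

Lemma mean_indic d (T : measurableType d) (mu : probability T R) (B : set T) :
  measurable B -> Rintegral mu setT (\1_B : T -> R) = fine (mu B).
Proof. by move=> mB; rewrite /Rintegral integral_indic// setIT. Qed.

Section iid.
Context dO dT (O : measurableType dO) (T : measurableType dT).
Context (P : probability O R) (D : probability T R) (n : nat) (Z : 'I_n -> O -> T).
Hypothesis iidZ : iid_sample P D Z.

Let mZ i : measurable_fun setT (Z i). Proof. by case: iidZ. Qed.

Lemma iid_mean_indic (B : 'I_n -> set T) : (forall i, measurable (B i)) ->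
  Rintegral P setT (fun w => \prod_(i < n) (\1_(B i) (Z i w) : R)) =
  \prod_(i < n) Rintegral D setT (\1_(B i) : T -> R).
Proof.
case: iidZ => _ lawZ indZ mB.
pose S := \bigcap_(i in [set: 'I_n]) (Z i @^-1` B i).
have mS : measurable S.
  apply: fin_bigcap_measurable => // i _.
  by rewrite -[X in measurable X]setTI; exact: mZ.
have -> : (fun w => \prod_(i < n) (\1_(B i) (Z i w) : R)) = \1_S.
  apply/funext => w; rewrite indicE.
  have [/set_mem wS|wS] := boolP (w \in S).
    by rewrite big1// => i _; rewrite indicE mem_set//; exact: wS.
  have : ~ (forall i, B i (Z i w)).
    by move=> h; move/negP: wS; apply; apply/mem_set => i _; exact: h.
  move/existsNP => [i Bi]; rewrite (bigD1 i)//= indicE memNset ?mul0r//.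
rewrite mean_indic// indZ//.
under eq_bigr do rewrite lawZ//.
under [RHS]eq_bigr do rewrite mean_indic//.
have fD i : D (B i) = (fine (D (B i)))%:E.
  by rewrite fineK//; exact: fin_num_measure.
under eq_bigr do rewrite fD.
by rewrite prodEFin.
Qed.

(* Indicators are replaced by bounded measurable functions one factor at a time. *)
Lemma iid_mean_prod (G : 'I_n -> T -> R) : (forall i, bmfun (G i)) ->
  Rintegral P setT (fun w => \prod_(i < n) G i (Z i w)) =
  \prod_(i < n) Rintegral D setT (G i).
Proof.
suff H m : forall G : 'I_n -> T -> R, (forall i, bmfun (G i)) ->
    (forall i : 'I_n, (m <= i)%N -> exists2 B, measurable B & G i = \1_B) ->
    Rintegral P setT (fun w => \prod_(i < n) G i (Z i w)) =
    \prod_(i < n) Rintegral D setT (G i).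
  by move=> bG; apply: (H n) => // i; rewrite leqNgt ltn_ord.
elim: m => [|m IH] {}G bG GB.
  have /choice[B HB] : forall i, exists B, measurable B /\ G i = \1_B.
    by move=> i; have [B mB ->] := GB i (leq0n i); exists B.
  under eq_bigr do rewrite (HB _).2.
  rewrite -iid_mean_indic; last by move=> i; case: (HB i).
  by congr Rintegral; apply/funext => w; apply: eq_bigr => i _; rewrite (HB i).2.
have [nm|mn] := leqP n m.
  apply: IH => // i mi; have := leq_trans nm mi.
  by rewrite leqNgt ltn_ord.
pose j := Ordinal mn.
pose H w := \prod_(i < n | i != j) G i (Z i w).
pose c := \prod_(i < n | i != j) Rintegral D setT (G i).
have bH : bmfun H.
  by apply: bmfun_prod => i; exact: bmfun_comp (mZ i) (bG i).
have bfH f : bmfun f -> bmfun (fun w => f (Z j w) * H w).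
  by move=> bf; apply: bmfunM => //; exact: bmfun_comp (mZ j) bf.
pose Phi (f : T -> R) := Rintegral P setT (fun w => f (Z j w) * H w)
  - c * Rintegral D setT f.
have [_ [KH HK]] := bH.
have : Phi (G j) = 0.
  apply: (@bounded_linear_eq0 _ _ _ _ (KH + `|c|)) => //.
  - move=> f g bf bg; rewrite /Phi meanD//.
    under eq_Rintegral do rewrite mulrDl.
    by rewrite meanD//; [ring|exact: bfH..].
  - move=> r f bf; rewrite /Phi meanZ//.
    under eq_Rintegral do rewrite -mulrA.
    by rewrite meanZ; [ring|exact: bfH].
  - move=> f e bf fe; rewrite /Phi mulrDl (le_trans (ler_normB _ _))// lerD//.
      apply: norm_mean_le; first exact: bfH.
      by move=> w; rewrite normrM mulrC ler_pM.
    by rewrite normrM ler_wpM2l//; exact: norm_mean_le.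
  move=> B mB; pose G' i := if i == j then \1_B else G i.
  have G'j : G' j = \1_B by rewrite /G' eqxx.
  have G'i i : i != j -> G' i = G i by rewrite /G' => /negbTE ->.
  have := IH G'.
  rewrite (bigD1 j)//= G'j.
  rewrite [X in _ * X](eq_bigr (fun i => Rintegral D setT (G i))); last first.
    by move=> i ij; rewrite G'i.
  rewrite -/c /Phi mulrC => <-.
  - apply/eqP; rewrite subr_eq0; apply/eqP.
    congr Rintegral; apply/funext => w; rewrite (bigD1 j)//= G'j.
    by congr (_ * _); apply: eq_bigr => i ij; rewrite G'i.
  - by move=> i; rewrite /G'; case: ifP => // _; exact: bmfun_indic.
  move=> i mi; rewrite /G'; case: eqVneq => [_|ij]; first by exists B.
  by apply: GB; rewrite ltn_neqAle mi andbT eq_sym;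
    apply: contra ij => /eqP ij; apply/eqP/val_inj.
rewrite /Phi => /eqP; rewrite subr_eq0 => /eqP.
move=> E; transitivity (c * Rintegral D setT (G j)); last first.
  by rewrite [RHS](bigD1 j)//= mulrC.
rewrite -E.
by congr Rintegral; apply/funext => w; rewrite (bigD1 j).
Qed.

End iid.
End Independence.

Section PACBayes.
Context {R : realType}.
#[local] Set Implicit Arguments.
#[local] Unset Strict Implicit.

Definition gap d d' (T : measurableType d) (U : measurableType d')
    (D : probability T R) (n : nat) (S : 'I_n -> T) (f : T * U -> R) (u : U) : R :=
  Rintegral D setT (fun z => f (z, u)) - n%:R^-1 * \sum_(i < n) f (S i, u).

Section gap.
Context dT dU (T : measurableType dT) (U : measurableType dU).
Context (D : probability T R) (nu0 : probability U R) (n : nat).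
Implicit Types (S : 'I_n -> T) (f : T * U -> R).

Lemma bmfun_mean1 f : bmfun f -> bmfun (fun u => Rintegral D setT (fun z => f (z, u))).
Proof.
move=> bf; apply: (@bmfun_mean2 _ _ _ _ _ D (fun uz => f (uz.2, uz.1))).
by apply: bmfun_comp bf; exact: measurable_swap.
Qed.

Lemma bmfun_gap S f : bmfun f -> bmfun (gap D S f).
Proof.
move=> bf; apply: bmfunB; first exact: bmfun_mean1.
by apply: bmfunZ; apply: bmfun_sum => i; exact: bmfun_snd.
Qed.

Lemma bmfun_gap2 dO (O : measurableType dO) (Z : 'I_n -> O -> T) f :
  (forall i, measurable_fun setT (Z i)) -> bmfun f ->
  bmfun (fun wu : O * U => gap D (fun i => Z i wu.1) f wu.2).
Proof.
move=> mZ bf; apply: bmfunB.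
  exact: (bmfun_comp measurable_snd (bmfun_mean1 bf)).
apply: bmfunZ; apply: bmfun_sum => i; apply: bmfun_comp bf.
by apply/measurable_fun_pair => //=; exact: measurableT_comp.
Qed.

Lemma mean_gap (nu : probability U R) S f : bmfun f ->
  Rintegral nu setT (gap D S f) =
  Rintegral D setT (fun z => Rintegral nu setT (fun u => f (z, u))) -
  n%:R^-1 * \sum_(i < n) Rintegral nu setT (fun u => f (S i, u)).
Proof.
move=> bf; have bfi i : bmfun (fun u => f (S i, u)) by exact: bmfun_snd.
rewrite /gap meanB; [|exact: bmfun_mean1|by apply: bmfunZ; exact: bmfun_sum].
by rewrite meanZ ?mean_sum// ?mean_fubini_sym ?mean_fubini//; exact: bmfun_sum.
Qed.

Lemma gap_le (a b : R) S f u : bmfun f -> (forall zu, a <= f zu <= b) -> (0 < n)%N ->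
  gap D S f u <= b - a.
Proof.
move=> bf fab n0; rewrite /gap lerB//.
  rewrite -(mean_cst D b); apply: le_mean; [exact: bmfun_fst|exact: bmfun_cst|].
  by move=> z; case/andP: (fab (z, u)).
rewrite mulrC ler_pdivlMr ?ltr0n// mulr_natr -[X in _ *+ X](card_ord n) -sumr_const.
by apply: ler_sum => i _; case/andP: (fab (S i, u)).
Qed.

Lemma gap_le_add (e : R) S f g u : bmfun f -> bmfun g ->
  (forall zu, `|f zu - g zu| <= e) -> (0 < n)%N ->
  gap D S f u <= gap D S g u + 2 * e.
Proof.
move=> bf bg fg n0; rewrite /gap.
have h1 : Rintegral D setT (fun z => f (z, u)) <=
    Rintegral D setT (fun z => g (z, u)) + e.
  rewrite -(mean_cst D e) -meanD; [|exact: bmfun_fst|exact: bmfun_cst].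
  apply: le_mean; first exact: bmfun_fst.
    by apply: bmfunD; [exact: bmfun_fst|exact: bmfun_cst].
  by move=> z; have := fg (z, u); rewrite ler_norml => /andP[]; lra.
have h2 : n%:R^-1 * \sum_(i < n) g (S i, u) <= n%:R^-1 * \sum_(i < n) f (S i, u) + e.
  have n1 : (0 : R) < n%:R by rewrite ltr0n.
  have -> : e = n%:R^-1 * \sum_(i < n) e.
    by rewrite sumr_const card_ord -[e *+ n]mulr_natl mulKf// gt_eqF.
  rewrite -mulrDr -big_split/= ler_pM2l ?invr_gt0//; apply: ler_sum => i _.
  by have := fg (S i, u); rewrite ler_norml => /andP[]; lra.
lra.
Qed.

Context dO (O : measurableType dO) (P : probability O R) (Z : 'I_n -> O -> T).
Hypothesis iidZ : iid_sample P D Z.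
Hypothesis n_gt0 : (0 < n)%N.

Let mZ i : measurable_fun setT (Z i). Proof. by case: iidZ. Qed.

Lemma mean_expR_gap (a b : R) f u : bmfun f -> (forall zu, a <= f zu <= b) ->
  Rintegral P setT (fun w => expR (Num.sqrt n%:R * gap D (fun i => Z i w) f u)) <=
  expR (2 * (b - a) ^+ 2).
Proof.
move=> bf fab; set t := (Num.sqrt n%:R : R)^-1.
pose m := Rintegral D setT (fun z => f (z, u)).
have bfu : bmfun (fun z => f (z, u)) by exact: bmfun_fst.
have n1 : (0 : R) < n%:R by rewrite ltr0n.
have s0 : (0 : R) < Num.sqrt n%:R by rewrite sqrtr_gt0.
have ss : (Num.sqrt n%:R : R) * Num.sqrt n%:R = n%:R by rewrite -expr2 sqr_sqrtr// ltW.
have -> : (fun w => expR (Num.sqrt n%:R * gap D (fun i => Z i w) f u)) =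
    (fun w => \prod_(i < n) expR (t * (m - f (Z i w, u)))).
  apply/funext => w; rewrite -expR_sum; congr expR.
  rewrite -mulr_sumr sumrB sumr_const card_ord /gap -/m -[m *+ n]mulr_natr.
  have key (q N S x : R) : q != 0 -> q * q = N ->
      q * (x - N^-1 * S) = q^-1 * (x * N - S).
    by move=> q0 <-; field.
  by rewrite key// gt_eqF.
rewrite (iid_mean_prod iidZ (G := fun _ z => expR (t * (m - f (z, u))))); last first.
  move=> _; apply: bmfun_expR; apply: bmfunZ; apply: bmfunB => //; exact: bmfun_cst.
apply: (@le_trans _ _ (\prod_(i < n) expR (2 * (t * (b - a)) ^+ 2))).
  apply: ler_prod => i _; apply/andP; split.
    by apply: Rintegral_ge0 => z _; exact: expR_ge0.
  exact: mean_expR_centered.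
rewrite -expR_sum sumr_const card_ord ler_expR -[X in X <= _]mulr_natr.
have -> // : 2 * (t * (b - a)) ^+ 2 * n%:R = 2 * (b - a) ^+ 2.
have key (q N x : R) : q != 0 -> q * q = N -> 2 * (q^-1 * x) ^+ 2 * N = 2 * x ^+ 2.
  by move=> q0 <-; field.
by rewrite key// gt_eqF.
Qed.

Lemma pac_bayes_event (a b delta : R) (M : nat) (f : 'I_M -> T * U -> R) :
  0 < delta -> (0 < M)%N ->
  (forall v, bmfun (f v)) -> (forall v zu, a <= f v zu <= b) ->
  exists E : set O, [/\ measurable E, ((1 - delta)%:E <= P E)%E &
    forall w, E w -> forall v, Rintegral nu0 setT
      (fun u => expR (Num.sqrt n%:R * gap D (fun i => Z i w) (f v) u)) <=
      M%:R * expR (2 * (b - a) ^+ 2) / delta].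
Proof.
move=> d0 M0 bf fab.
pose F v (wu : O * U) := expR (Num.sqrt n%:R * gap D (fun i => Z i wu.1) (f v) wu.2).
have bF v : bmfun (F v) by apply: bmfun_expR; apply: bmfunZ; exact: bmfun_gap2.
pose V v w := Rintegral nu0 setT (fun u => F v (w, u)).
have bV v : bmfun (V v) by exact: (@bmfun_mean2 _ _ _ _ _ nu0 (F v)).
have V0 v w : 0 <= V v w by apply: Rintegral_ge0 => u _; exact: expR_ge0.
pose B := M%:R * expR (2 * (b - a) ^+ 2).
have B0 : 0 < B by rewrite mulr_gt0 ?ltr0n ?expR_gt0.
have bS : bmfun (fun w => \sum_(v < M) V v w) by exact: bmfun_sum.
have mV : Rintegral P setT (fun w => \sum_(v < M) V v w) <= B.
  rewrite mean_sum// /B mulr_natl -[X in _ *+ X](card_ord M) -sumr_const.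
  apply: ler_sum => v _; rewrite /V mean_fubini// -mean_fubini_sym//.
  rewrite -(mean_cst nu0 (expR _)); apply: le_mean.
  - apply: (@bmfun_mean2 _ _ _ _ _ P (fun uw => F v (uw.2, uw.1))).
    by apply: bmfun_comp (bF v); exact: measurable_swap.
  - exact: bmfun_cst.
  by move=> u; exact: mean_expR_gap.
pose E := [set w | \sum_(v < M) V v w <= B / delta].
have mE : measurable E.
  have := bS.1 measurableT _ (measurable_itv `]-oo, (B / delta)]).
  by rewrite setTI; congr measurable; apply/seteqP; split => w /=; rewrite in_itv.
exists E; split => //; last first.
  move=> w Ew v; apply: le_trans _ Ew; rewrite (bigD1 v)//= lerDl.
  by apply: sumr_ge0 => i _; exact: V0.
have PE : P E = (Rintegral P setT (\1_E : O -> R))%:E.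
  by rewrite mean_indic// fineK//; exact: fin_num_measure.
rewrite PE lee_fin.
have bdB : bmfun (fun w => delta / B * \sum_(v < M) V v w) by exact: bmfunZ.
apply: (@le_trans _ _
  (Rintegral P setT (fun w => 1 - delta / B * \sum_(v < M) V v w))).
  rewrite meanB ?mean_cst ?meanZ//; last exact: bmfun_cst.
  rewrite lerB// mulrAC ler_pdivrMr// ler_pM2l//.
apply: le_mean.
- by apply: bmfunB => //; exact: bmfun_cst.
- exact: bmfun_indic.
move=> w; rewrite indicE; have [Ew|Ew] := boolP (w \in E).
  rewrite lerBlDr lerDl; apply: mulr_ge0; first by rewrite divr_ge0 ?ltW.
  by apply: sumr_ge0 => i _; exact: V0.
have : B / delta < \sum_(v < M) V v w.
  by rewrite ltNge; apply/negP => h; move/negP: Ew; apply; exact: mem_set.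
move=> h; rewrite subr_le0 mulrAC ler_pdivlMr// mul1r mulrC -ler_pdivrMr//.
exact: ltW.
Qed.

End gap.
End PACBayes.

(** * The finite net and the rate *)

Section Net.
Context {R : realType}.
#[local] Set Implicit Arguments.
#[local] Unset Strict Implicit.

Lemma sqr_le_enorm2 p (v : 'rV[R]_p) j : v ord0 j ^+ 2 <= enorm2 v.
Proof.
by rewrite /enorm2 (bigD1 j)//= lerDl; apply: sumr_ge0 => i _; exact: sqr_ge0.
Qed.

Lemma enorm_le p (v : 'rV[R]_p) (e : R) : 0 <= e ->
  (forall j, `|v ord0 j| <= e) -> enorm v <= Num.sqrt p%:R * e.
Proof.
move=> e0 ve; rewrite /enorm -[X in _ * X](ger0_norm e0) -sqrtr_sqr -sqrtrM//.
rewrite ler_wsqrtr// mulr_natl -[X in _ *+ X](card_ord p) -sumr_const.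
by apply: ler_sum => j _; rewrite -real_normK ?num_real// lerXn2r ?nnegrE.
Qed.

Lemma finite_net p (W : set 'rV[R]_p) (w0 : 'rV[R]_p) (n B : nat) :
  W w0 -> (0 < n)%N ->
  exists v : {ffun 'I_p -> 'I_(2 * n ^ 2 * B).+1} -> 'rV[R]_p,
    (forall c, W (v c)) /\
    forall w, W w -> (forall j, `|(w - w0) ord0 j| <= n%:R * B%:R) ->
      exists c, enorm (w - v c) <= Num.sqrt p%:R / n%:R.
Proof.
move=> Ww0 n0; have n1 : (0 : R) < n%:R by rewrite ltr0n.
pose box w := forall j, `|(w - w0) ord0 j| <= n%:R * B%:R.
pose t (w : 'rV[R]_p) j := n%:R * ((w - w0) ord0 j + n%:R * B%:R).
pose cell (w : 'rV[R]_p) : {ffun 'I_p -> 'I_(2 * n ^ 2 * B).+1} :=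
  [ffun j => inord (Num.truncn (t w j))].
have /choice[v Hv] : forall c, exists v, W v /\
    forall w, W w -> box w -> cell w = c -> box v /\ cell v = c.
  move=> c.
  have [[v [Wv bv cv]]|h] := pselect (exists v, [/\ W v, box v & cell v = c]).
    by exists v; split.
  by exists w0; split => // w Ww bw cw; exfalso; apply: h; exists w.
exists v; split => [c|w Ww bw]; first by case: (Hv c).
exists (cell w); have [_ /(_ w Ww bw erefl)[bv cv]] := Hv (cell w).
apply: enorm_le => [|j]; first by rewrite invr_ge0 ltW.
have tP u : box u -> 0 <= t u j /\ (Num.truncn (t u j) < (2 * n ^ 2 * B).+1)%N.
  move=> bu; have := bu j; rewrite ler_norml => /andP[u1 u2].
  have t0 : 0 <= t u j by rewrite mulr_ge0 ?(ltW n1)//; lra.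
  split => //; rewrite ltnS -(@ler_nat R) (le_trans (_ : _ <= t u j))//.
    by rewrite truncn_le.
  rewrite /t.
  have -> : (2 * n ^ 2 * B)%:R = n%:R * (n%:R * B%:R + n%:R * B%:R) :> R.
    by rewrite !natrM; ring.
  by rewrite ler_pM2l// lerD2r.
have [tw0 tw1] := tP _ bw; have [tv0 tv1] := tP _ bv.
have : Num.truncn (t (v (cell w)) j) = Num.truncn (t w j).
  by have := congr1 
    (fun c : {ffun 'I_p -> 'I_(2 * n ^ 2 * B).+1} => nat_of_ord (c j)) cv;
    rewrite /= !ffunE !inordK.
have /andP[a1 a2] := truncn_itv tw0; have /andP[b1 b2] := truncn_itv tv0.
move=> E; rewrite E in b1 b2.
have : `|t w j - t (v (cell w)) j| <= 1.
  by move: a2 b2; rewrite -natr1 ler_norml => *; apply/andP; split; lra.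
have -> : t w j - t (v (cell w)) j = n%:R * (w - v (cell w)) ord0 j.
  by rewrite /t !mxE; ring.
by rewrite normrM gtr0_norm// mulrC -ler_pdivlMr// mul1r.
Qed.

End Net.

Section Rate.
Context {R : realType}.
#[local] Set Implicit Arguments.
#[local] Unset Strict Implicit.

Definition rate (p B : nat) (L a b delta : R) (n : nat) : R :=
  let y := (Num.sqrt (Num.sqrt n%:R))^-1 in
  2 * `|L| * Num.sqrt p%:R * y ^+ 4 +
  (p%:R * ln (2 * B + 1)%:R + 2 * (b - a) ^+ 2 - ln delta) * y ^+ 2 +
  8 * p%:R * y.

Lemma rate_cvg0 p B (L a b delta : R) : rate p B L a b delta @ \oo --> 0.
Proof.
have y0 : (Num.sqrt (Num.sqrt (n%:R : R)))^-1 @[n --> \oo] --> (0 : R).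
  have sq (u : nat -> R) : u n @[n --> \oo] --> 0 -> Num.sqrt (u n) @[n --> \oo] --> 0.
    by move=> u0; rewrite -[X in _ --> X]sqrtr0; apply: continuous_cvg => //;
      exact: sqrt_continuous.
  under eq_fun do rewrite -sqrtrV ?sqrtr_ge0// -sqrtrV//.
  apply: (sq); apply: (sq); apply/gtr0_cvgV0; last exact: cvgr_idn.
  by near=> n; rewrite ltr0n; near: n; exact: nbhs_infty_gt.
rewrite /rate.
have c0 (c : R) (u : nat -> R) : u n @[n --> \oo] --> 0 -> c * u n @[n --> \oo] --> 0.
  by move=> u0; rewrite -(mulr0 c); apply: cvgMr.
have X0 k : (Num.sqrt (Num.sqrt (n%:R : R)))^-1 ^+ k.+1 @[n --> \oo] --> (0 : R).
  elim: k => [//|k ih]; under eq_fun do rewrite exprS.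
  by rewrite -(mulr0 0); apply: cvgM.
rewrite -[X in _ --> X]addr0 -[X in _ --> X + _]addr0.
by apply: cvgD; [apply: cvgD|]; apply: c0 => //; exact: X0.
Unshelve. all: by end_near.
Qed.

Lemma rate_ge0 p B (L a b delta : R) n : 0 < delta <= 1 -> 0 <= rate p B L a b delta n.
Proof.
move=> /andP[d0 d1]; rewrite /rate.
set y := _^-1; have y0 : 0 <= y by rewrite invr_ge0 sqrtr_ge0.
have ld : ln delta <= 0 by rewrite ln_le0.
have lB : 0 <= ln (2 * B + 1)%:R :> R by rewrite ln_ge0// ler1n addn1.
apply: addr_ge0; [apply: addr_ge0|].
- by rewrite mulr_ge0 ?exprn_ge0// !mulr_ge0 ?sqrtr_ge0.
- rewrite mulr_ge0 ?exprn_ge0// subr_ge0 (le_trans ld)// addr_ge0//.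
    by rewrite mulr_ge0.
  by rewrite mulr_ge0// sqr_ge0.
- by rewrite !mulr_ge0.
Qed.

Lemma rate_ge p B (L a b delta : R) n : 0 < delta <= 1 -> (0 < n)%N ->
  2 * (`|L| * (Num.sqrt p%:R / n%:R)) +
  (Num.sqrt n%:R)^-1 *
    ln (((2 * n ^ 2 * B).+1 ^ p)%:R * expR (2 * (b - a) ^+ 2) / delta)
  <= rate p B L a b delta n.
Proof.
move=> /andP[d0 d1] n0; rewrite /rate.
have n1 : (0 : R) < n%:R by rewrite ltr0n.
set q := Num.sqrt (Num.sqrt n%:R).
have q0 : 0 < q by rewrite !sqrtr_gt0.
have qq : Num.sqrt n%:R = q ^+ 2 by rewrite sqr_sqrtr// sqrtr_ge0.
have qqqq : n%:R = q ^+ 4 by rewrite -[4%N]/(2 * 2)%N exprM -qq sqr_sqrtr// ltW.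
have M0 : 0 < ((2 * n ^ 2 * B).+1)%:R :> R by rewrite ltr0n.
rewrite ln_div ?posrE ?mulr_gt0 ?expR_gt0 ?ltr0n ?expn_gt0//.
rewrite lnM ?posrE ?expR_gt0 ?ltr0n ?expn_gt0// expRK natrX lnXn//.
have B0 : (0 : R) < (2 * B + 1)%:R by rewrite ltr0n addn1.
have lnM : ln ((2 * n ^ 2 * B).+1)%:R <= ln (2 * B + 1)%:R + 8 * q.
  apply: (@le_trans _ _ (ln ((2 * B + 1)%:R * n%:R ^+ 2))).
    rewrite ler_ln ?posrE ?mulr_gt0 ?exprn_gt0//.
    by rewrite -natrX -natrM ler_nat; nia.
  rewrite lnM ?posrE ?exprn_gt0// lerD2l lnXn// qqqq lnXn//.
  have := @ln_le_sub1 R q q0; rewrite -!mulrnA -mulr_natl; lra.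
rewrite qq qqqq.
have p0 : (0 : R) <= p%:R by [].
have h : p%:R * ln ((2 * n ^ 2 * B).+1)%:R <= p%:R * (ln (2 * B + 1)%:R + 8 * q).
  by rewrite ler_wpM2l.
have q20 : 0 < (q ^+ 2)^-1 by rewrite invr_gt0 exprn_gt0.
set X := ln _ in h *; set Y := ln _ in h *; set Dl := ln delta.
rewrite -[X *+ p]mulr_natl.
have h2 : (q ^+ 2)^-1 * (p%:R * X + 2 * (b - a) ^+ 2 - Dl) <=
    (q ^+ 2)^-1 * (p%:R * (Y + 8 * q) + 2 * (b - a) ^+ 2 - Dl).
  by rewrite ler_pM2l// lerD2r lerD2r.
apply: le_trans (lerD (lexx _) h2) _.
by rewrite le_eqVlt; apply/orP; left; apply/eqP; field; rewrite gt_eqF.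
Qed.

End Rate.

(** * The bound *)

Section TRMBound.
#[local] Set Implicit Arguments.
#[local] Unset Strict Implicit.
Context {R : realType} (p : nat) (s L a b delta : R).
Hypothesis s_gt0 : 0 < s.
Hypothesis delta01 : 0 < delta <= 1.
Context (dX dY : measure_display) (X : measurableType dX) (Y : measurableType dY)
  (Y' : Type) (D : probability (X * Y)%type R)
  (W : set 'rV[R]_p) (h : 'rV[R]_p -> X -> Y') (l : Y' -> Y -> R)
  (beta : R) (w0 : 'rV[R]_p)
  (k K : nat) (A : 'I_K -> R) (N : 'I_K -> nat) (rho : 'I_K -> R -> X -> X).
Hypothesis l_bound : forall y' y, a <= l y' y <= b.
Hypothesis l_lip : forall (x : X) (y : Y) (w w' : 'rV[R]_p), W w -> W w' ->
  `| l (h w x) y - l (h w' x) y | <= L * enorm (w - w').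
Hypothesis beta01 : 0 < beta < 1.
Hypothesis Ww0 : W w0.
Hypothesis A_gt0 : forall i : 'I_K, (i < k)%N -> 0 < A i.
Hypothesis N_ge2 : forall i : 'I_K, (k <= i)%N -> (2 <= N i)%N.
Hypothesis l_meas : forall w, W w ->
  measurable_fun (setT `*` Aset k A N)
    (fun za : ((X * Y) * K.-tuple R)%type => l (h w (gmap rho za.2 za.1.1)) za.1.2).

Definition loss (w : 'rV[R]_p) (zu : (X * Y) * K.-tuple R) : R :=
  l (h w (gmap rho (retractA k N A zu.2) zu.1.1)) zu.1.2.

Lemma loss_bound w zu : a <= loss w zu <= b.
Proof. exact: l_bound. Qed.

Lemma bmfun_loss w : W w -> bmfun (loss w).
Proof.
move=> Ww; split; last first.
  exists (Num.max `|a| `|b|) => zu; have /andP[la lb] := loss_bound w zu.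
  rewrite le_max; have [l0|l0] := leP 0 (loss w zu).
    by rewrite ger0_norm// (le_trans lb (ler_norm _)) orbT.
  by rewrite ltr0_norm// -(normrN a) (le_trans _ (ler_norm _))// lerN2.
apply: (measurable_comp (F := setT `*` Aset k A N)
  (g := fun zu : (X * Y) * K.-tuple R => (zu.1, retractA k N A zu.2)) _ _ (l_meas Ww)).
- by apply: measurableX => //; exact: measurable_Aset.
- by move=> _ [zu _ <-]; split => //=; exact: retractA_in.
apply/measurable_fun_pair => //=.
by apply: measurableT_comp => //; exact: measurable_retractA.
Qed.

Section theta.
Context (alpha pi : 'I_K -> R).
Hypothesis alphaA : forall i : 'I_K, (i < k)%N -> 0 < alpha i <= A i.
Hypothesis pi01 : forall i : 'I_K, 0 <= pi i <= 1.

Lemma R_TRM_gap w n (S : 'I_n -> (X * Y)%type) : W w ->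
  R_TRM D h l k N rho w alpha pi - R_TRM_n S h l k N rho w alpha pi =
  QE k N alpha pi (gap D S (loss w)).
Proof.
move=> Ww; have bl := bmfun_loss Ww.
have [nu Hnu] := QE_mean N_ge2 alphaA pi01.
have E z : QE k N alpha pi (fun u => l (h w (gmap rho u z.1)) z.2) =
    Rintegral nu setT (fun u => loss w (z, u)).
  by rewrite (QE_retract A_gt0 N_ge2 _ _ alphaA)// Hnu//; exact: (bmfun_snd z bl).
rewrite Hnu; last exact: bmfun_gap _ _ bl.
rewrite mean_gap//; congr (_ - _ * _).
  by congr Rintegral; apply/funext => z; exact: E.
by apply: eq_bigr => i _; exact: E.
Qed.

Lemma R_TRM_gap_le w n (S : 'I_n -> (X * Y)%type) : W w -> (0 < n)%N ->
  R_TRM D h l k N rho w alpha pi - R_TRM_n S h l k N rho w alpha pi <= b - a.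
Proof.
move=> Ww n0; rewrite R_TRM_gap//; have bl := bmfun_loss Ww.
have [nu Hnu] := QE_mean N_ge2 alphaA pi01.
have bg := bmfun_gap D S bl.
rewrite Hnu// -(mean_cst nu (b - a)); apply: le_mean => //; first exact: bmfun_cst.
by move=> u; apply: gap_le => //; exact: loss_bound.
Qed.

Lemma R_TRM_gap_DV w v n (S : 'I_n -> (X * Y)%type) (e B : R) :
  W w -> W v -> (0 < n)%N -> 0 < B ->
  (forall zu, `|loss w zu - loss v zu| <= e) ->
  QE k N A (fun=> 1 - beta)
    (fun u => expR (Num.sqrt n%:R * gap D S (loss v) u)) <= B ->
  Num.sqrt n%:R *
    (R_TRM D h l k N rho w alpha pi - R_TRM_n S h l k N rho w alpha pi) <=
  Reg k A N beta alpha pi + Num.sqrt n%:R * (2 * e) + ln B.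
Proof.
move=> Ww Wv n0 B0 wv QB; rewrite R_TRM_gap//.
have bw := bmfun_loss Ww; have bv := bmfun_loss Wv.
have AA (i : 'I_K) : (i < k)%N -> 0 < A i <= A i by move=> /A_gt0 ->; rewrite lexx.
have p01 (i : 'I_K) : 0 <= 1 - beta <= 1 by have /andP[] := beta01; lra.
have [nu Hnu] := QE_mean N_ge2 alphaA pi01.
have [nu0 Hnu0] := @QE_mean R K k N A N_ge2 A (fun _ => 1 - beta) AA p01.
have bgw : bmfun (fun u => Num.sqrt n%:R * gap D S (loss w) u).
  by apply: bmfunZ; exact: bmfun_gap _ _ bw.
have bgv : bmfun (fun u => Num.sqrt n%:R * gap D S (loss v) u).
  by apply: bmfunZ; exact: bmfun_gap _ _ bv.
have DV := DV_QE beta01 A_gt0 N_ge2 alphaA pi01 bgw.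
rewrite Hnu; last exact: bmfun_gap _ _ bw.
rewrite -meanZ; last exact: bmfun_gap _ _ bw.
rewrite -Hnu//; apply: (le_trans DV); rewrite -addrA lerD2l.
rewrite Hnu0; last exact: bmfun_expR.
have ge0 : 0 < Rintegral nu0 setT (fun u => expR (Num.sqrt n%:R * gap D S (loss w) u)).
  have [_ [M HM]] := bgw; apply: lt_le_trans (expR_gt0 (- M)) _.
  apply: mean_ge; first exact: bmfun_expR.
  by move=> u; rewrite ler_expR; have := HM u; rewrite ler_norml => /andP[].
rewrite -[X in X + _]expRK -lnM ?posrE ?expR_gt0// ler_ln ?posrE ?mulr_gt0 ?expR_gt0//.
rewrite Hnu0 in QB; last exact: bmfun_expR.
apply: (@le_trans _ _ (expR (Num.sqrt n%:R * (2 * e)) *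
  Rintegral nu0 setT (fun u => expR (Num.sqrt n%:R * gap D S (loss v) u)))); last first.
  by rewrite ler_wpM2l ?expR_ge0.
rewrite -meanZ; last exact: bmfun_expR.
apply: le_mean; [exact: bmfun_expR|by apply: bmfunZ; exact: bmfun_expR|].
move=> u; rewrite -expRD ler_expR -mulrDr ler_wpM2l ?sqrtr_ge0// addrC.
exact: gap_le_add.
Qed.

End theta.

(* Chosen so that [penalty_ge] holds outside the cube of half-width [n * cutoff]. *)
Definition cutoff : nat := (Num.truncn (2 * s ^+ 2 * (b - a))).+1.

Lemma penalty_ge (w : 'rV[R]_p) n : (0 < n)%N ->
  (exists j, n%:R * cutoff%:R < `|(w - w0) ord0 j|) ->
  b - a <= (Num.sqrt n%:R)^-1 * ((2 * s ^+ 2)^-1 * enorm2 (w - w0)).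
Proof.
move=> n0 [j wj].
have n1 : (1 : R) <= n%:R by rewrite ler1n.
have c1 : (1 : R) <= cutoff%:R by rewrite ler1n.
have cb : 2 * s ^+ 2 * (b - a) <= cutoff%:R by apply/ltW; exact: truncnS_gt.
have q0 : (0 : R) < Num.sqrt n%:R by rewrite sqrtr_gt0 ltr0n.
have qq : (Num.sqrt n%:R : R) ^+ 2 = n%:R by rewrite sqr_sqrtr// ler0n.
have s2 : 0 < 2 * s ^+ 2 by rewrite mulr_gt0// exprn_gt0.
rewrite mulrA -invfM mulrC ler_pdivlMr ?mulr_gt0//.
apply: (@le_trans _ _ ((n%:R * cutoff%:R) ^+ 2)); last first.
  apply: le_trans (sqr_le_enorm2 _ j); rewrite -(real_normK (num_real ((w - w0) _ _))).
  by rewrite lerXn2r ?nnegrE ?mulr_ge0// ltW.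
have -> : (b - a) * (Num.sqrt n%:R * (2 * s ^+ 2)) =
  Num.sqrt n%:R * (2 * s ^+ 2 * (b - a)) by ring.
apply: (@le_trans _ _ (Num.sqrt n%:R * cutoff%:R)); first by rewrite ler_pM2l.
rewrite exprMn; apply: ler_pM => //.
  have q1 : 1 <= Num.sqrt n%:R :> R by rewrite -{1}sqrtr1 ler_wsqrtr.
  by apply: (@le_trans _ _ n%:R); [rewrite -[leRHS]qq ler_eXnr|rewrite ler_eXnr].
by rewrite ler_eXnr.
Qed.

Lemma TRM_bound n (n_gt0 : (0 < n)%N) (dO : measure_display) (O : measurableType dO)
    (P : probability O R) (Z : 'I_n -> O -> (X * Y)%type) :
  iid_sample P D Z ->
  exists E : set O, [/\ measurable E, ((1 - delta)%:E <= P E)%E &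
    forall omega, E omega ->
    forall (w : 'rV[R]_p) (alpha pi : 'I_K -> R), W w ->
      (forall i : 'I_K, (i < k)%N -> 0 < alpha i <= A i) ->
      (forall i : 'I_K, 0 <= pi i <= 1) ->
      R_TRM D h l k N rho w alpha pi <=
        R_TRM_n (fun i => Z i omega) h l k N rho w alpha pi
        + (Num.sqrt n%:R)^-1 *
            ((2 * s ^+ 2)^-1 * enorm2 (w - w0) + Reg k A N beta alpha pi)
        + rate p cutoff L a b delta n].
Proof.
move=> iidZ; have /andP[d0 d1] := delta01.
have AA (i : 'I_K) : (i < k)%N -> 0 < A i <= A i by move=> /A_gt0 ->; rewrite lexx.
have p01 (i : 'I_K) : 0 <= 1 - beta <= 1 by have /andP[] := beta01; lra.
have [nu0 Hnu0] := @QE_mean R K k N A N_ge2 A (fun _ => 1 - beta) AA p01.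
have [v [Wv Hv]] := finite_net cutoff Ww0 n_gt0.
pose cellT : finType := {ffun 'I_p -> 'I_(2 * n ^ 2 * cutoff).+1}.
have cardM : #|cellT| = ((2 * n ^ 2 * cutoff).+1 ^ p)%N.
  by rewrite card_ffun !card_ord.
pose f (i : 'I_#|cellT|) := loss (v (enum_val i)).
have bf i : bmfun (f i) by exact: bmfun_loss.
have fab i zu : a <= f i zu <= b by exact: loss_bound.
have M0 : (0 < #|cellT|)%N by rewrite cardM expn_gt0.
have [E [mE PE HE]] := pac_bayes_event nu0 iidZ n_gt0 d0 M0 bf fab.
exists E; split => // omega Eo w alpha pi Ww alphaA pi01.
have Reg0 := Reg_ge0 beta01 A_gt0 N_ge2 alphaA pi01.
have q0 : (0 : R) < Num.sqrt n%:R by rewrite sqrtr_gt0 ltr0n.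
have qi : (0 : R) < (Num.sqrt n%:R)^-1 by rewrite invr_gt0.
have s2 : 0 <= (2 * s ^+ 2)^-1 by rewrite invr_ge0 mulr_ge0// sqr_ge0.
set Rn := R_TRM_n _ _ _ _ _ _ _ _ _.
have [bw|] := pselect (forall j, `|(w - w0) ord0 j| <= n%:R * cutoff%:R); last first.
  move=> /existsNP[j /negP]; rewrite -ltNge => wj.
  have h1 := R_TRM_gap_le alphaA pi01 (fun i => Z i omega) Ww n_gt0.
  have h2 := penalty_ge n_gt0 (ex_intro _ j wj).
  have h3 := rate_ge0 p cutoff L a b n delta01.
  have h4 : 0 <= (Num.sqrt n%:R)^-1 * Reg k A N beta alpha pi.
    by rewrite mulr_ge0// ltW.
  rewrite mulrDr -addrA -lerBlDl (le_trans h1)// (le_trans h2)//.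
  by rewrite -addrA lerDl addr_ge0.
have [c wc] := Hv w Ww bw.
set e := `|L| * (Num.sqrt p%:R / n%:R).
have le zu : `|loss w zu - loss (v c) zu| <= e.
  rewrite (le_trans (l_lip _ _ _ _))//.
  rewrite (le_trans (ler_wpM2r (sqrtr_ge0 _) (ler_norm L)))//.
  by rewrite ler_wpM2l.
set B := (((2 * n ^ 2 * cutoff).+1 ^ p)%:R * expR (2 * (b - a) ^+ 2) / delta : R).
have B0 : 0 < B by rewrite !mulr_gt0 ?expR_gt0 ?invr_gt0// ltr0n expn_gt0.
have QB : QE k N A (fun=> 1 - beta)
    (fun u => expR (Num.sqrt n%:R * gap D (fun i => Z i omega) (loss (v c)) u)) <= B.
  rewrite Hnu0; last first.
    by apply: bmfun_expR; apply: bmfunZ; exact: (bmfun_gap _ _ (bmfun_loss (Wv c))).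
  have := HE _ Eo (enum_rank (c : cellT)); rewrite /f enum_rankK.
  by rewrite /B cardM.
have DV := R_TRM_gap_DV alphaA pi01 Ww (Wv c) n_gt0 B0 le QB.
have := rate_ge p cutoff L a b delta01 n_gt0.
rewrite -/B -/e => r1.
have r2 : 0 <= (Num.sqrt n%:R)^-1 * ((2 * s ^+ 2)^-1 * enorm2 (w - w0)).
  rewrite mulr_ge0 ?(ltW qi)// mulr_ge0//.
  by apply: sumr_ge0 => j _; exact: sqr_ge0.
have r3 : R_TRM D h l k N rho w alpha pi - Rn <=
    (Num.sqrt n%:R)^-1 * (Reg k A N beta alpha pi + Num.sqrt n%:R * (2 * e) + ln B).
  by rewrite mulrC ler_pdivlMr// mulrC.
rewrite mulrDr -addrA -lerBlDl (le_trans r3)// !mulrDr mulKf ?gt_eqF//.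
by rewrite -addrA lerD// lerDr.
Qed.

End TRMBound.

Theorem theorem1 (R : realType) (p : nat) (s L a b delta : R) :
  0 < s -> 0 < delta <= 1 ->
  exists c : nat -> R, c @ \oo --> 0 /\
  forall (dX dY : measure_display) (X : measurableType dX) (Y : measurableType dY)
    (Y' : Type) (D : probability (X * Y)%type R)
    (W : set 'rV[R]_p) (h : 'rV[R]_p -> X -> Y') (l : Y' -> Y -> R)
    (beta : R) (w0 : 'rV[R]_p)
    (k K : nat) (A : 'I_K -> R) (N : 'I_K -> nat) (rho : 'I_K -> R -> X -> X),
    (* bounded loss *)
    (forall (y' : Y') (y : Y), a <= l y' y <= b) ->
    (* w |-> l(h_w(x), y) is L-Lipschitz on W *)
    (forall (x : X) (y : Y) (w w' : 'rV[R]_p), W w -> W w' ->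
        `| l (h w x) y - l (h w' x) y | <= L * enorm (w - w')) ->
    0 < beta < 1 -> W w0 ->
    (* transformations *)
    (k <= K)%N ->
    (forall i : 'I_K, (i < k)%N -> 0 < A i) ->
    (forall i : 'I_K, (k <= i)%N -> (2 <= N i)%N) ->
    (forall i : 'I_K, rho i 0 = id) ->
    (* measurability (implicit in the paper): (x, y, a) |-> l(h_w(g_a x), y) *)
    (forall w, W w ->
        measurable_fun (setT `*` Aset k A N)
          (fun za : ((X * Y) * K.-tuple R)%type => l (h w (gmap rho za.2 za.1.1)) za.1.2)) ->
    forall n : nat, (0 < n)%N ->
    forall (dO : measure_display) (O : measurableType dO) (P : probability O R)
      (Z : 'I_n -> O -> (X * Y)%type),
      iid_sample P D Z ->
      exists E : set O, [/\ measurable E, ((1 - delta)%:E <= P E)%E &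
        forall omega, E omega ->
        forall (w : 'rV[R]_p) (alpha pi : 'I_K -> R), W w ->
          (forall i : 'I_K, (i < k)%N -> 0 < alpha i <= A i) ->
          (forall i : 'I_K, 0 <= pi i <= 1) ->
          R_TRM D h l k N rho w alpha pi <=
            R_TRM_n (fun i => Z i omega) h l k N rho w alpha pi
            + (Num.sqrt n%:R)^-1 *
                ((2 * s ^+ 2)^-1 * enorm2 (w - w0) + Reg k A N beta alpha pi)
            + c n].

Proof.
move=> s0 d01; exists (rate p (cutoff s a b) L a b delta).
split; first exact: rate_cvg0.
move=> dX dY X Y Y' D W h l beta w0 k K A N rho lb ll b01 Ww0 _ A0 N2 _ lm.
move=> n n0 dO O P Z iidZ.
exact: (TRM_bound s0 d01 lb ll b01 Ww0 A0 N2 lm n0 iidZ).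
Qed.
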